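(* Let $\Psi\in C^{1,\alpha_0}(\overline{B_1'})$, $f^\pm\in C(\Omega^\pm)\cap L^\infty(B_1)$, $g\in L^\infty(\Gamma)$, and let $u\in C(\overline{B_1})$ satisfy, in the viscosity sense, $$\omega(x)\mathcal M^-(D^2u)\le f^\pm\ \text{ in }\Omega^\pm,\qquad u^+_\nu-u^-_\nu\le g\ \text{ on }\Gamma.$$ Then $$\sup_{B_1}u_-\le\sup_{\partial B_1}u_-+C\Big(\max_\Gamma g_++\|f^-_+\|_{L^d_\omega(\Omega^-)}+\|f^+_+\|_{L^d_\omega(\Omega^+)}\Big),$$ with $C$ depending only on $d,\lambda,\Lambda,\Psi$ and $a$.
   Context: Notation: $x=(x',x_d)\in\mathbb R^{d-1}\times\mathbb R$, $B_r$, $B_r'$ balls centered at $0$ in $\mathbb R^d$, $\mathbb R^{d-1}$. $0<\lambda\le\Lambda$; $\alpha_0\in(0,1)$ is the universal interior $C^{1,\alpha_0}$ exponent for $(\lambda,\Lambda)$-uniformly elliptic equations $F(D^2u)=0$. $\Omega^\pm=B_1\cap\{\pm(x_d-\Psi(x'))>0\}$, $\Gamma=B_1\cap\{x_d=\Psi(x')\}$, $\nu$ the unit normal to $\Gamma$ pointing into $\Omega^+$. $a:B_1\to[0,1)$ is continuous with $\max a<1$ and $\omega(x)=|x_d-\Psi(x')|^{a(x)}$; $\|f\|_{L^d_\omega(U)}:=\|f\omega^{-1}\|_{L^d(U)}$. $u_-=\max(-u,0)$, $h_+=\max(h,0)$. Pucci operators: $\mathcal M^+(M)=\Lambda\sum_{e_i>0}e_i+\lambda\sum_{e_i<0}e_i$,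 $\mathcal M^-(M)=\lambda\sum_{e_i>0}e_i+\Lambda\sum_{e_i<0}e_i$, $e_i$ eigenvalues of $M$. ''$\omega\mathcal M^-(D^2u)\le f^\pm$ in $\Omega^\pm$ in the viscosity sense'' means: for any $\varphi\in C^2$ touching $u$ from below at $x_0\in\Omega^\pm$, $\omega(x_0)\mathcal M^-(D^2\varphi(x_0))\le f^\pm(x_0)$. ''$u^+_\nu-u^-_\nu\le g$ on $\Gamma$ in the viscosity sense'' means: for any $x_0\in\Gamma$ and any $\varphi$ that is $C^1$ on $B_\delta(x_0)\cap\overline{\Omega^+}$ and on $B_\delta(x_0)\cap\overline{\Omega^-}$ touching $u$ from below at $x_0$, $\varphi^+_\nu(x_0)-\varphi^-_\nu(x_0)\le g(x_0)$, where $\varphi^\pm_\nu$ is the normal derivative of $\varphi|_{\overline{\Omega^\pm}}$. *)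

(* Defs.v *)
From HB Require Import structures.
From mathcomp Require Import all_boot all_order all_algebra.
From mathcomp Require Import all_classical all_reals all_analysis.
Set Implicit Arguments. Unset Strict Implicit. Unset Printing Implicit Defensive.
Import Order.TTheory GRing.Theory Num.Theory.
Import numFieldNormedType.Exports.
Local Open Scope classical_set_scope.
Local Open Scope ring_scope.

Section Defs.
Variable R : realType.

Definition dotv k (v w : 'rV[R]_k) : R := \sum_(i < k) v ord0 i * w ord0 i.
(* Euclidean norm (the library norm on 'rV is the max-norm, so we define it) *)
Definition enorm k (v : 'rV[R]_k) : R := Num.sqrt (dotv v v).
Definition eball k (y : 'rV[R]_k) (r : R) : set 'rV[R]_k :=
  [set x | enorm (x - y) < r].
Definition ecball k (y : 'rV[R]_k) (r : R) : set 'rV[R]_k :=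
  [set x | enorm (x - y) <= r].
Definition esphere k (y : 'rV[R]_k) (r : R) : set 'rV[R]_k :=
  [set x | enorm (x - y) = r].

Definition evec k (i : 'I_k) : 'rV[R]_k := delta_mx ord0 i.
Definition partial k (i : 'I_k) (phi : 'rV[R]_k -> R) : 'rV[R]_k -> R :=
  fun x => 'D_(evec i) phi x.
Definition grad k (phi : 'rV[R]_k -> R) (x : 'rV[R]_k) : 'rV[R]_k :=
  \row_i partial i phi x.
Definition hess k (phi : 'rV[R]_k -> R) (x : 'rV[R]_k) : 'M[R]_k :=
  \matrix_(i, j) partial i (partial j phi) x.

Definition C1on k (U : set 'rV[R]_k) (phi : 'rV[R]_k -> R) : Prop :=
  (forall x, U x -> {for x, continuous phi}) /\
  forall i : 'I_k, (forall x, U x -> derivable phi x (evec i)) /\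
    (forall x, U x -> {for x, continuous (partial i phi)}).
Definition C2on k (U : set 'rV[R]_k) (phi : 'rV[R]_k -> R) : Prop :=
  C1on U phi /\ forall i : 'I_k, C1on U (partial i phi).

Definition eigvals k (M : 'M[R]_k) : 'rV[R]_k :=
  xget 0 [set e : 'rV[R]_k | char_poly M = \prod_(i < k) ('X - (e ord0 i)%:P)].
Definition PucciPlus (lam Lam : R) k (M : 'M[R]_k) : R :=
  let e := eigvals M in
  Lam * (\sum_(i < k | 0 < e ord0 i) e ord0 i) + lam * (\sum_(i < k | e ord0 i < 0) e ord0 i).
Definition PucciMinus (lam Lam : R) k (M : 'M[R]_k) : R :=
  let e := eigvals M in
  lam * (\sum_(i < k | 0 < e ord0 i) e ord0 i) + Lam * (\sum_(i < k | e ord0 i < 0) e ord0 i).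

Variable n : nat.
Local Notation d := n.+2.
Definition xprime (x : 'rV[R]_d) : 'rV[R]_(n.+1) :=
  \row_(i < n.+1) x ord0 (widen_ord (leqnSn _) i).
Definition xlast (x : 'rV[R]_d) : R := x ord0 ord_max.

Definition B1 : set 'rV[R]_d := eball 0 1.
Definition cB1 : set 'rV[R]_d := ecball 0 1.
Definition dB1 : set 'rV[R]_d := esphere 0 1.
Definition B1' : set 'rV[R]_(n.+1) := eball 0 1.

Definition OmegaP (Psi : 'rV[R]_(n.+1) -> R) : set 'rV[R]_d :=
  [set x | B1 x /\ 0 < xlast x - Psi (xprime x)].
Definition OmegaM (Psi : 'rV[R]_(n.+1) -> R) : set 'rV[R]_d :=
  [set x | B1 x /\ 0 < - (xlast x - Psi (xprime x))].
Definition Gamma (Psi : 'rV[R]_(n.+1) -> R) : set 'rV[R]_d :=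
  [set x | B1 x /\ xlast x = Psi (xprime x)].

(* unit normal to Gamma (graph of Psi) pointing into Omega^+ *)
Definition nu (Psi : 'rV[R]_(n.+1) -> R) (x : 'rV[R]_d) : 'rV[R]_d :=
  let G := grad Psi (xprime x) in
  (Num.sqrt (1 + enorm G ^+ 2))^-1 *:
    \row_(i < d) (if (i : nat) == n.+1 then 1 else - G ord0 (inord i)).

Definition C1alpha_B1' (alpha : R) (Psi : 'rV[R]_(n.+1) -> R) : Prop :=
  (forall y, B1' y -> differentiable Psi y) /\
  exists K : R, forall y z, B1' y -> B1' z ->
    enorm (grad Psi y - grad Psi z) <= K * powR (enorm (y - z)) alpha.

Definition omega (Psi : 'rV[R]_(n.+1) -> R) (a : 'rV[R]_d -> R) (x : 'rV[R]_d) : R :=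
  powR `|xlast x - Psi (xprime x)| (a x).

(* integral over R^k of a nonnegative function of k real variables, computed
   as the iterated one-dimensional Lebesgue integral (Tonelli) *)
Fixpoint iter_int (k : nat) (F : seq R -> \bar R) : \bar R :=
  match k with
  | 0 => F [::]
  | k.+1 => (\int[@lebesgue_measure R]_(t in setT) iter_int k (fun s => F (t :: s)))%E
  end.
Definition pt (s : seq R) : 'rV[R]_d := \row_(i < d) nth 0 s i.
Definition integral_Rd (h : 'rV[R]_d -> \bar R) : \bar R :=
  iter_int d (fun s => h (pt s)).

Definition LdNorm_omega (Psi : 'rV[R]_(n.+1) -> R) (a : 'rV[R]_d -> R)
    (U : set 'rV[R]_d) (h : 'rV[R]_d -> R) : \bar R :=
  poweR (integral_Rd (fun x => (\1_U x * `|h x / omega Psi a x| ^+ d)%:E)) (d%:R^-1).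

Definition visc_super_bulk (lam Lam : R) (Psi : 'rV[R]_(n.+1) -> R) (a : 'rV[R]_d -> R)
   (Omega : set 'rV[R]_d) (f u : 'rV[R]_d -> R) : Prop :=
  forall x0 (phi : 'rV[R]_d -> R), Omega x0 ->
    (exists r, 0 < r /\ C2on (eball x0 r) phi /\
       phi x0 = u x0 /\ forall x, eball x0 r x -> cB1 x -> phi x <= u x) ->
    omega Psi a x0 * PucciMinus lam Lam (hess phi x0) <= f x0.

Definition visc_super_interface (Psi : 'rV[R]_(n.+1) -> R) (g u : 'rV[R]_d -> R) : Prop :=
  forall x0 (delta : R) (phi phiP phiM : 'rV[R]_d -> R), Gamma Psi x0 -> 0 < delta ->
    C1on (eball x0 delta) phiP -> C1on (eball x0 delta) phiM ->
    (forall x, eball x0 delta x -> closure (OmegaP Psi) x -> phi x = phiP x) ->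
    (forall x, eball x0 delta x -> closure (OmegaM Psi) x -> phi x = phiM x) ->
    phi x0 = u x0 -> (forall x, eball x0 delta x -> cB1 x -> phi x <= u x) ->
    dotv (grad phiP x0) (nu Psi x0) - dotv (grad phiM x0) (nu Psi x0) <= g x0.

End Defs.

(* Main.v *)
Require Import Defs.
From HB Require Import structures.
From mathcomp Require Import all_boot all_order all_algebra.
From mathcomp Require Import all_classical all_reals all_analysis.
From mathcomp Require Import measurable_realfun.
From mathcomp Require Import complex ring lra.
Set Implicit Arguments. Unset Strict Implicit. Unset Printing Implicit Defensive.
Import Order.TTheory GRing.Theory Num.Theory.
Import numFieldNormedType.Exports.
Local Open Scope classical_set_scope.
Local Open Scope ring_scope.

(* The area formula in the ABP argument is replaced by counting. For y in B_1' let B(y, .) be the barrier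
     - T - M T_+^(1+alpha) + N |X|^(1+alpha) + Q |X|^2,
   where X is the position relative to the point of Gamma above y and T the height over the tangent plane
   at that point. B is nonnegative on and below Gamma, and B(x', x) <= - (x_d - Psi(x')) / 2 for x just above it. Hence,
   if G > 2 max g_+, then u + G min(0, B(y, .)) - p.x, minimized over y as well as x, has no minimum on Gamma.
   In the bulk M^-(D^2 (-B)) >= - C where B < 0, so there the new term changes the equation only by G C.

   Call p a contact slope at x if x and some y minimize u + G min(0, B(y, .)) - p.x. If u_- exceeds its
   boundary values by H at some point, all |p| <= H/8 are contact slopes, at points bounded away from the
   boundary of B_1. Comparing two contact points at distance at most s with one quadratic test function shows
   that their slopes differ by at most C s (f_+ / omega + G C), up to the oscillation of f_+ / omega. Cutting
   B_1 into small cubes, the slopes of contact points of each cube fit into a ball of that radius; since these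
   balls cover a ball of radius H/8, the sum of their volumes, which is a lower Riemann sum for the d-th power
   of the norms on the right-hand side, is at least a multiple of H^d. *)

(** Gamma is only of class C^(1,alpha), so its height function has no Hessian to insert into the
    Pucci operator. Each B(y, .), built from a single tangent plane, can be touched by paraboloids
    with a uniform Pucci bound, but it has the right kink only above its own y. Minimizing over y
    reconciles the two: in the bulk the minimizing y is frozen, whereas at Gamma the minimum is
    compared with y = z' for every nearby z. The quotient f_+ / omega may be unbounded near Gamma,
    so it has no global modulus of continuity. Contact points, however, stay away from Gamma and
    from the sphere, and compactness of the set of all (x, y, p) yields one radius on which f_+ /
    omega is almost constant around each of them. This makes a finite count possible, without convex
    envelopes or a measurable contact set. The bound H/8 is a budget: H/4 for the level that
    separates contact points from the sphere, H/4 for G min(0, B), and H/4 for p.x across the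
    diameter 2, in all less than H. If G max |min(0, B)| could exceed H/4, then H is already bounded
    by a multiple of G. *)

(** * The Euclidean norm *)

Section Euclid.
Context {R : realType} {k : nat}.
Implicit Types (v w z : 'rV[R]_k) (a r : R).

Lemma dotvC v w : dotv v w = dotv w v.
Proof. by apply: eq_bigr => i _; rewrite mulrC. Qed.

Lemma dotvDl v w z : dotv (v + w) z = dotv v z + dotv w z.
Proof. by rewrite /dotv -big_split; apply: eq_bigr => i _; rewrite mxE mulrDl. Qed.

Lemma dotvZl a v w : dotv (a *: v) w = a * dotv v w.
Proof. by rewrite /dotv mulr_sumr; apply: eq_bigr => i _; rewrite mxE mulrA. Qed.

Lemma dotvNl v w : dotv (- v) w = - dotv v w.
Proof. by rewrite -scaleN1r dotvZl mulN1r. Qed.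

Lemma dotvBl v w z : dotv (v - w) z = dotv v z - dotv w z.
Proof. by rewrite dotvDl dotvNl. Qed.

Lemma dotvDr v w z : dotv z (v + w) = dotv z v + dotv z w.
Proof. by rewrite !(dotvC z) dotvDl. Qed.

Lemma dotvZr a v w : dotv w (a *: v) = a * dotv w v.
Proof. by rewrite !(dotvC w) dotvZl. Qed.

Lemma dotvNr v w : dotv w (- v) = - dotv w v.
Proof. by rewrite !(dotvC w) dotvNl. Qed.

Lemma dotvBr v w z : dotv z (v - w) = dotv z v - dotv z w.
Proof. by rewrite dotvDr dotvNr. Qed.

Lemma dotv0l v : dotv 0 v = 0.
Proof. by rewrite -(scale0r v) dotvZl mul0r. Qed.

Lemma dotv0r v : dotv v 0 = 0.
Proof. by rewrite dotvC dotv0l. Qed.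

Definition dotvE := (dotvDl, dotvDr, dotvBl, dotvBr, dotvNl, dotvNr, dotvZl, dotvZr).

Lemma dotv_ge0 v : 0 <= dotv v v.
Proof. by apply: sumr_ge0 => i _; rewrite -expr2 sqr_ge0. Qed.

Lemma enorm_ge0 v : 0 <= enorm v.
Proof. exact: sqrtr_ge0. Qed.
Hint Resolve enorm_ge0 : core.

Lemma sqr_enorm v : enorm v ^+ 2 = dotv v v.
Proof. by rewrite sqr_sqrtr ?dotv_ge0. Qed.

Lemma dotv_eq0 v : dotv v v = 0 -> v = 0.
Proof.
move=> /eqP; rewrite psumr_eq0; last by move=> i _; rewrite -expr2 sqr_ge0.
move=> /allP h; apply/rowP => i; rewrite mxE; apply/eqP.
by have := h i (mem_index_enum i); rewrite -expr2 sqrf_eq0.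
Qed.

Lemma enorm0 : enorm (0 : 'rV[R]_k) = 0.
Proof. by rewrite /enorm dotv0l sqrtr0. Qed.

Lemma enorm_eq0 v : enorm v = 0 -> v = 0.
Proof. by move=> h; apply: dotv_eq0; rewrite -sqr_enorm h expr0n. Qed.

Lemma enorm_gt0 v : v != 0 -> 0 < enorm v.
Proof.
by move=> v0; rewrite lt0r enorm_ge0 andbT; apply: contra_neq v0 => /enorm_eq0.
Qed.

Lemma cauchy_schwarz v w : `|dotv v w| <= enorm v * enorm w.
Proof.
have [->|w0] := eqVneq w 0; first by rewrite dotv0r normr0 enorm0 mulr0.
have ww : 0 < dotv w w by rewrite -sqr_enorm exprn_gt0// enorm_gt0.
rewrite -(ler_pXn2r (_ : (0 < 2)%N)) ?nnegrE ?mulr_ge0//.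
rewrite exprMn !sqr_enorm real_normK ?num_real//.
have := dotv_ge0 (dotv w w *: v - dotv v w *: w).
rewrite !dotvE (dotvC w v) => h.
have : 0 <= dotv w w * (dotv v v * dotv w w - dotv v w ^+ 2) by nra.
by rewrite pmulr_rge0// subr_ge0.
Qed.

Lemma dotv_le v w : dotv v w <= enorm v * enorm w.
Proof. exact: le_trans (ler_norm _) (cauchy_schwarz _ _). Qed.

Lemma enormD v w : enorm (v + w) <= enorm v + enorm w.
Proof.
rewrite -(ler_pXn2r (_ : (0 < 2)%N)) ?nnegrE ?addr_ge0//.
rewrite sqrrD !sqr_enorm !dotvE (dotvC w v).
have := dotv_le v w; lra.
Qed.

Lemma enormZ a v : enorm (a *: v) = `|a| * enorm v.
Proof. by rewrite /enorm !dotvE mulrA -expr2 sqrtrM ?sqr_ge0// sqrtr_sqr. Qed.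

Lemma enormN v : enorm (- v) = enorm v.
Proof. by rewrite -scaleN1r enormZ normrN1 mul1r. Qed.

Lemma enormBC v w : enorm (v - w) = enorm (w - v).
Proof. by rewrite -enormN opprB. Qed.

Lemma enormB v w : enorm (v - w) <= enorm v + enorm w.
Proof. by rewrite -(enormN w) enormD. Qed.

Lemma enorm_dist v w z : enorm (v - w) <= enorm (v - z) + enorm (z - w).
Proof. by rewrite (le_trans _ (enormD _ _))// addrA subrK. Qed.

Lemma coord_le_enorm v i : `|v ord0 i| <= enorm v.
Proof.
rewrite -sqrtr_sqr ler_sqrt ?dotv_ge0// /dotv (bigD1 i)//= expr2 lerDl.
by apply: sumr_ge0 => j _; rewrite -expr2 sqr_ge0.
Qed.

Lemma enorm_le_coord v r : 0 <= r -> (forall i, `|v ord0 i| <= r) -> enorm v <= k%:R * r.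
Proof.
move=> r0 h; rewrite -(ler_pXn2r (_ : (0 < 2)%N)) ?nnegrE ?mulr_ge0//.
rewrite sqr_enorm exprMn.
have : dotv v v <= \sum_(i < k) r ^+ 2.
  by apply: ler_sum => i _; rewrite -expr2 -real_normK ?num_real// ler_pXn2r ?nnegrE.
move=> /le_trans; apply; rewrite sumr_const card_ord -[X in X <= _]mulr_natl.
rewrite ler_wpM2r ?sqr_ge0// -natrX ler_nat.
by case: {v h} k => // n; rewrite expnS leq_pmulr.
Qed.

Lemma enorm_evec (i : 'I_k) : enorm (evec R i) = 1.
Proof.
rewrite /enorm /dotv (bigD1 i)//= big1 ?addr0.
  by rewrite !mxE !eqxx mulr1 sqrtr1.
by move=> j ji; rewrite !mxE (negbTE ji) andbF mulr0.
Qed.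

Lemma dotv_evec v i : dotv v (evec R i) = v ord0 i.
Proof.
rewrite /dotv (bigD1 i)//= big1 ?addr0; first by rewrite !mxE !eqxx mulr1.
by move=> j ji; rewrite !mxE (negbTE ji) andbF mulr0.
Qed.

Lemma mx_norm_le_enorm v : `|v| <= enorm v.
Proof.
by rewrite /Num.norm/= mx_normrE; apply/bigmax_leP; split => // -[i j] _/=;
  rewrite ord1; exact: coord_le_enorm.
Qed.

Lemma enorm_le_mx_norm v : enorm v <= k%:R * `|v|.
Proof.
apply: enorm_le_coord => // i.
rewrite [X in _ <= X]/Num.norm/= mx_normrE.
exact: (@le_bigmax _ _ _ 0 (fun ij : 'I_1 * 'I_k => `|v ij.1 ij.2|) (ord0, i)).
Qed.

Lemma coord_comp_continuous (T : topologicalType) (f : T -> 'rV[R]_k) (x : T) i :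
  {for x, continuous f} -> {for x, continuous (fun y => f y ord0 i)}.
Proof.
move=> cf; apply: (@continuous_comp _ _ _ f (fun M => M ord0 i)) => //.
exact: coord_continuous.
Qed.

Lemma dotv_continuous (T : topologicalType) (f g : T -> 'rV[R]_k) (x : T) :
  {for x, continuous f} -> {for x, continuous g} ->
  {for x, continuous (fun y => dotv (f y) (g y))}.
Proof.
move=> cf cg; rewrite /dotv /continuous_at.
apply: (@cvg_big _ _ +%R).
  by move=> ?; apply: add_continuous.
move=> i _; apply: cvgM.
  exact: coord_comp_continuous.
exact: coord_comp_continuous.
Qed.

Lemma enorm_continuous (T : topologicalType) (f : T -> 'rV[R]_k) (x : T) :
  {for x, continuous f} -> {for x, continuous (fun y => enorm (f y))}.
Proof.
move=> cf; apply: (@continuous_comp _ _ _ (fun y => dotv (f y) (f y)) Num.sqrt).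
  exact: dotv_continuous.
exact: sqrt_continuous.
Qed.

Lemma eball_nbhs v r : 0 < r -> nbhs v (eball v r).
Proof.
move=> r0; have kr : 0 < r / (k%:R + 1) by rewrite divr_gt0// ltr_wpDl.
apply/nbhs_ballP; exists (r / (k%:R + 1)) => //= w.
rewrite -ball_normE/= => h; rewrite /eball/= enormBC.
rewrite (le_lt_trans (enorm_le_mx_norm _))//.
rewrite (@le_lt_trans _ _ ((k%:R + 1) * `|v - w|))//; first by rewrite ler_wpM2r// lerDl.
by rewrite mulrC -ltr_pdivlMr// ltr_wpDl.
Qed.

Lemma nbhs_eball v (A : set 'rV[R]_k) : nbhs v A -> exists2 r, 0 < r & eball v r `<=` A.
Proof.
move=> /nbhs_ballP[r /= r0 h]; exists r => // w wv; apply: h.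
by rewrite -ball_normE/= (le_lt_trans (mx_norm_le_enorm _))// enormBC.
Qed.

Lemma ecball_compact v r : compact (ecball v r).
Proof.
apply: bounded_closed_compact.
  exists (enorm v + r); split; first exact: num_real.
  move=> M Mr w /= wr; rewrite (le_trans (mx_norm_le_enorm _))//.
  have := enormD v (w - v); rewrite addrC subrK; move: wr; rewrite /ecball/=; lra.
rewrite (_ : ecball v r = (fun w => enorm (w - v)) @^-1` [set x | x <= r])//.
apply: preimage_closed; last exact: closed_le.
move=> w _; apply: (@enorm_continuous _ (fun w => w - v)).
by apply: continuousB => //; exact: cst_continuous.
Qed.

Lemma enorm_continuous_at (T : topologicalType) (f : T -> 'rV[R]_k) (x : T) :
  (forall e, 0 < e -> \forall z \near x, enorm (f x - f z) < e) ->
  {for x, continuous f}.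
Proof.
move=> h; apply/cvg_ballP => e e0.
have := h e e0; apply: filterS => z hz.
by rewrite -ball_normE/= (le_lt_trans (mx_norm_le_enorm _)).
Qed.

End Euclid.
#[global] Hint Extern 0 (is_true (0 <= enorm _)) => exact: enorm_ge0 : core.

(** * Pucci operators and quadratic test functions *)

Section Pucci.
Context {R : realType} {k : nat}.
Implicit Types (S : 'M[R]_k) (v : 'rV[R]_k).

(** Computing v A v^* from both sides gives z |v|^2 = conj(z) |v|^2 with |v|^2 nonzero. *)
Lemma sym_eigenvalue_real S (z : R[i]) :
  S^T = S -> eigenvalue (map_mx (real_complex R) S) z -> z = (complex.Re z)%:C%C.
Proof.
move=> St /eigenvalueP[v vS v0].
set A := map_mx _ S in vS.
pose vc : 'cV[R[i]]_k := map_mx (fun x => x^*%C) v^T.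
have Avc : A *m vc = (z^*)%C *: vc.
  have At : A^T = A by rewrite /A map_trmx St.
  have -> : vc = (map_mx (@conjc R) v)^T by rewrite /vc map_trmx.
  rewrite -{1}At -trmx_mul.
  have <- : map_mx (@conjc R) (v *m A) = map_mx (@conjc R) v *m A.
    rewrite map_mxM; congr (_ *m _).
    by apply/matrixP => i j; rewrite !mxE /= oppr0.
  by rewrite vS map_mxZ linearZ.
have e : (z - z^*%C) *: (v *m vc) = 0.
  by rewrite scalerBl scalemxAl -vS -mulmxA Avc -scalemxAr subrr.
have vv : (v *m vc) ord0 ord0 != 0.
  apply: contra_neq v0; rewrite mxE => /eqP.
  under eq_bigr do rewrite !mxE.
  rewrite psumr_eq0; last by move=> i _; exact: mul_conjC_ge0.
  move=> /allP h; apply/rowP => i; rewrite mxE; apply/eqP.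
  by have := h i (mem_index_enum i); rewrite mul_conjC_eq0.
move/matrixP/(_ ord0 ord0): e; rewrite !mxE => /eqP.
rewrite mulf_eq0 => /orP[|]; last by rewrite -[X in X == 0]/(_); rewrite mxE in vv; rewrite (negbTE vv).
case: z {vS Avc} => a b; rewrite /= subr_eq0 => /eqP [] /eqP.
by rewrite -addr_eq0 -mulr2n mulrn_eq0/= => /eqP ->.
Qed.

(* [eigvals] has a junk default unless the characteristic polynomial splits. *)
Lemma sym_char_poly_split S : S^T = S ->
  exists e : 'rV[R]_k, char_poly S = \prod_(i < k) ('X - (e ord0 i)%:P).
Proof.
move=> St.
have [r hr] := closed_field_poly_normal (map_poly (real_complex R) (char_poly S)).
have mon : lead_coef (map_poly (real_complex R) (char_poly S)) = 1.
  by rewrite lead_coef_map_inj ?rmorph0 ?(monicP (char_poly_monic S)) ?rmorph1//; exact: complexI.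
rewrite mon scale1r in hr.
have sr : size r = k.
  have := congr1 (fun p => size (p : {poly _})) hr.
  by rewrite size_map_poly size_char_poly size_prod_XsubC => -[].
exists (\row_i complex.Re r`_i).
apply: (map_inj_poly (@complexI R)) => //; rewrite hr map_prod_XsubC.
rewrite (big_nth 0) big_mkord sr; apply: eq_bigr => i _; rewrite mxE.
congr ('X - _%:P); apply: (@sym_eigenvalue_real S) => //.
rewrite eigenvalue_root_char -map_char_poly hr root_prod_XsubC.
by rewrite mem_nth// sr.
Qed.

Lemma eigvalsP S : S^T = S ->
  char_poly S = \prod_(i < k) ('X - (eigvals S ord0 i)%:P).
Proof. by move=> St; rewrite /eigvals; case: xgetP => [//|]; move: (sym_char_poly_split St) => [e he] /(_ e). Qed.

Lemma PucciMinus_lower (lam Lam kap : R) S : 0 <= lam -> lam <= Lam -> 0 <= kap ->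
  S^T = S -> (forall v, - kap * dotv v v <= dotv (v *m S) v) ->
  lam * \tr S - (Lam - lam) * (k%:R * kap) <= PucciMinus lam Lam S.
Proof.
move=> l0 lL kap0 St psd.
have hc := eigvalsP St; rewrite /PucciMinus; set e := eigvals S in hc *.
have ek i : - kap <= e ord0 i.
  have : eigenvalue S (e ord0 i).
    rewrite eigenvalue_root_char hc /root horner_prod; apply/eqP.
    by rewrite (bigD1 i)//= !hornerE subrr mul0r.
  move=> /eigenvalueP[v vS v0]; have := psd v.
  by rewrite vS dotvZl -sqr_enorm ler_pM2r// exprn_gt0// enorm_gt0.
(* Both sides are minus the coefficient of degree k - 1 of the characteristic polynomial, which
   exists only for k > 0. *)
have tr : \tr S = \sum_(i < k) e ord0 i.
  case: k S St psd e hc ek => [|m] S' St psd e hc ek; first by rewrite /mxtrace !big_ord0.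
  have := char_poly_trace S' (ltn0Sn m); rewrite hc => h.
  apply: oppr_inj; rewrite -h.
  have := @coefPn_prod_XsubC R [seq e ord0 i | i <- enum 'I_m.+1].
  rewrite size_map size_enum_ord big_map big_enum/= => -> //.
  by rewrite big_map big_enum.
have sum3 : \sum_(i < k) e ord0 i =
    \sum_(i < k | 0 < e ord0 i) e ord0 i + \sum_(i < k | e ord0 i < 0) e ord0 i.
  rewrite [LHS](bigID (fun i => 0 < e ord0 i))/=; congr (_ + _).
  rewrite [LHS](bigID (fun i => e ord0 i < 0))/= [X in _ + X]big1 ?addr0.
    by apply: eq_bigl => i; case: ltgtP.
  by move=> i; case: ltgtP.
have neg : - (k%:R * kap) <= \sum_(i < k | e ord0 i < 0) e ord0 i.
  rewrite -mulrN mulr_natl -[X in _ *+ X]card_ord -sumr_const.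
  rewrite [X in X <= _](bigID (fun i => e ord0 i < 0))/=.
  rewrite -[X in _ <= X]addr0 lerD//; first by apply: ler_sum => i _.
  by apply: sumr_le0 => i _; rewrite oppr_le0.
rewrite tr sum3 mulrDr.
have : (Lam - lam) * (- (k%:R * kap)) <= (Lam - lam) * (\sum_(i < k | e ord0 i < 0) e ord0 i).
  by rewrite ler_wpM2l// subr_ge0.
by rewrite mulrBl; lra.
Qed.
End Pucci.

Section Quadratic.
Context {R : realType}.

Lemma derive_quad_exp (V : normedModType R) (f : V -> R) (a v : V) (A B : R) :
  (forall h, f (h *: v + a) = f a + h * A + h ^+ 2 * B) ->
  derivable f a v /\ 'D_v f a = A.
Proof.
move=> hf.
suff h : (fun h => h^-1 *: ((f \o shift a) (h *: v) - f a)) @ 0^' --> A.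
  by split; [apply/cvg_ex; exists A|exact: cvg_lim].
have : (fun h : R => A + h * B) @ 0^' --> A.
  have -> : nbhs A = nbhs (A + 0 * B) by rewrite mul0r addr0.
  apply: cvg_within_filter.
  by apply: cvgD; [exact: cvg_cst|apply: cvgMl; exact: cvg_id].
apply: cvg_trans; apply: near_eq_cvg; near=> h.
have h0 : h != 0 by near: h; exact: nbhs_dnbhs_neq.
rewrite /= hf /GRing.scale/=; field.
Unshelve. all: by end_near. Qed.

Context {k : nat}.
Implicit Types (x b v : 'rV[R]_k) (S : 'M[R]_k).

Definition quadf (c : R) b S (x1 : 'rV[R]_k) : 'rV[R]_k -> R :=
  fun x => c + dotv b (x - x1) + 2^-1 * dotv ((x - x1) *m S) (x - x1).

Lemma dotv_mulmx_sym S v x : S^T = S -> dotv (v *m S) x = dotv (x *m S) v.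
Proof.
have E (a c : 'rV[R]_k) : dotv a c = (a *m c^T) ord0 ord0.
  by rewrite mxE; apply: eq_bigr => i _; rewrite mxE.
move=> St; rewrite !E -[RHS](_ : (x *m S *m v^T)^T ord0 ord0 = _); last by rewrite mxE.
by rewrite !trmx_mul trmxK St mulmxA.
Qed.

Lemma quadf_line c b S x1 x v (h : R) : S^T = S ->
  quadf c b S x1 (h *: v + x) = quadf c b S x1 x
    + h * (dotv b v + dotv ((x - x1) *m S) v) + h ^+ 2 * (2^-1 * dotv (v *m S) v).
Proof.
move=> St; rewrite /quadf -[h *: v + x - x1]addrA; move: (x - x1) => z.
rewrite mulmxDl -scalemxAl !dotvE (dotv_mulmx_sym z v St).
by field.
Qed.

Lemma partial_quadf c b S x1 x i : S^T = S ->
  derivable (quadf c b S x1) x (evec R i) /\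
  partial i (quadf c b S x1) x = b ord0 i + ((x - x1) *m S) ord0 i.
Proof.
move=> St; rewrite -!dotv_evec.
exact: (derive_quad_exp (fun h => quadf_line c b x1 x (evec R i) h St)).
Qed.

(** The family is closed under partial derivatives (with zero matrix afterwards), so C^2 regularity
    and the Hessian follow by applying the first-order lemmas twice. *)
Lemma partial_quadfE c b S x1 i : S^T = S ->
  partial i (quadf c b S x1) = quadf (b ord0 i) (row i S) 0 x1.
Proof.
move=> St; apply/funext => x; have [_ ->] := partial_quadf c b x1 x i St.
rewrite /quadf mulmx0 dotv0l mulr0 addr0; congr (_ + _).
by rewrite mxE dotvC; apply: eq_bigr => j _; congr (_ * _); rewrite -{1}St !mxE.
Qed.

Lemma quadf_continuous c b S x1 : continuous (quadf c b S x1).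
Proof.
move=> x; rewrite /quadf /continuous_at.
have cd : {for x, continuous (fun y : 'rV[R]_k => y - x1)}.
  by apply: continuousB => //; exact: cst_continuous.
have c1 : {for x, continuous (fun y : 'rV[R]_k => dotv b (y - x1))}.
  by apply: dotv_continuous => //; exact: cst_continuous.
apply: (cvgD (cvgD (cvg_cst _) c1)); apply: cvgM; first exact: cvg_cst.
rewrite /dotv; apply: (@cvg_big _ _ +%R).
  by move=> ?; apply: add_continuous.
move=> i _; apply: cvgM; last first.
  exact: (coord_comp_continuous cd).
under eq_fun do rewrite mxE; rewrite mxE; apply: (@cvg_big _ _ +%R).
  by move=> ?; apply: add_continuous.
move=> j _; apply: cvgM; last exact: cvg_cst.
exact: (coord_comp_continuous cd).
Qed.

Lemma C1on_quadf U c b S x1 : S^T = S -> C1on U (quadf c b S x1).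
Proof.
move=> St; split=> [x _|i]; first exact: quadf_continuous.
split=> x _; first by have [] := partial_quadf c b x1 x i St.
by rewrite partial_quadfE//; exact: quadf_continuous.
Qed.

Lemma C2on_quadf U c b S x1 : S^T = S -> C2on U (quadf c b S x1).
Proof.
move=> St; split; first exact: C1on_quadf.
by move=> i; rewrite partial_quadfE//; apply: C1on_quadf; rewrite trmx0.
Qed.

Lemma hess_quadf c b S x1 x : S^T = S -> hess (quadf c b S x1) x = S.
Proof.
move=> St; apply/matrixP => i j; rewrite mxE partial_quadfE//.
have [_ ->] := partial_quadf (b ord0 j) (row j S) x1 x i (trmx0 _ _ _).
by rewrite mulmx0 !mxE addr0 -{2}St mxE.
Qed.

Lemma quadf_center c b S x1 : quadf c b S x1 x1 = c.
Proof. by rewrite /quadf subrr mul0mx !dotv0r mulr0 !addr0. Qed.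

Definition outer v : 'M[R]_k := v^T *m v.

Lemma outer_sym v : (outer v)^T = outer v.
Proof. by rewrite /outer trmx_mul trmxK. Qed.

Lemma dotv_outer v x : dotv (x *m outer v) x = dotv v x ^+ 2.
Proof.
have E (a c : 'rV[R]_k) : dotv a c = (a *m c^T) ord0 ord0.
  by rewrite mxE; apply: eq_bigr => i _; rewrite mxE.
rewrite /outer mulmxA E.
have -> : x *m v^T = (dotv x v)%:M by rewrite [LHS]mx11_scalar -E.
by rewrite mul_scalar_mx -scalemxAl mxE -E dotvC expr2.
Qed.

Lemma tr_outer v : \tr (outer v) = dotv v v.
Proof. by apply: eq_bigr => i _; rewrite mxE big_ord1 !mxE. Qed.

Lemma quadf_outer c b x1 (al gam kap : R) (e nn : 'rV[R]_k) x :
  quadf c b (al *: outer e + gam *: outer nn - kap%:M) x1 x =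
  c + dotv b (x - x1) + 2^-1 * (al * dotv e (x - x1) ^+ 2 + gam * dotv nn (x - x1) ^+ 2
     - kap * dotv (x - x1) (x - x1)).
Proof.
rewrite /quadf; move: (x - x1) => z.
by rewrite mulmxBr mulmxDr -!scalemxAr mul_mx_scalar !dotvE !dotv_outer.
Qed.

Lemma sym_outer_comb (al gam kap : R) (e nn : 'rV[R]_k) :
  (al *: outer e + gam *: outer nn - kap%:M)^T = al *: outer e + gam *: outer nn - kap%:M.
Proof. by rewrite linearB linearD !linearZ/= !outer_sym tr_scalar_mx. Qed.

(** Every Hessian tested below has this form: [al] is the convexity created by comparing two contact
    points, [gam] the convexity of minus the barrier along the normal, and [kap] collects all
    concavity. *)
Lemma PucciMinus_outer_comb (lam Lam al gam kap : R) (e nn : 'rV[R]_k) :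
  0 <= lam -> lam <= Lam -> 0 <= kap -> 0 <= al -> 0 <= gam ->
  lam * (al * dotv e e + gam * dotv nn nn) - Lam * (k%:R * kap)
  <= PucciMinus lam Lam (al *: outer e + gam *: outer nn - kap%:M).
Proof.
move=> l0 lL k0 a0 g0; apply: le_trans (PucciMinus_lower l0 lL k0 (sym_outer_comb _ _ _ _ _) _).
  rewrite mxtraceD linearN mxtraceD !mxtraceZ !tr_outer/= mxtrace_scalar -mulr_natl.
  by rewrite mulrBl mulrBr; lra.
move=> v; rewrite mulmxBr mulmxDr -!scalemxAr mul_mx_scalar !dotvE !dotv_outer.
have h1 : 0 <= al * dotv e v ^+ 2 by rewrite mulr_ge0// sqr_ge0.
have h2 : 0 <= gam * dotv nn v ^+ 2 by rewrite mulr_ge0// sqr_ge0.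
lra.
Qed.
End Quadratic.

(** * Real powers *)

Section Powers.
Context {R : realType}.
Implicit Types (a x s t p : R).

(** Weighted arithmetic-geometric mean: for m = x^a, apply 1 + ln z <= z to x / m and to 1 / m with
    weights a and 1 - a; the logarithms cancel. *)
Lemma powR_bernoulli a x : 0 <= a <= 1 -> 0 <= x -> powR x a <= 1 + a * (x - 1).
Proof.
move=> /andP[a0 a1]; rewrite le_eqVlt => /predU1P[<-|x0].
  rewrite /powR eqxx; case: eqP => [->|_] /=; lra.
have m0 : 0 < powR x a by exact: powR_gt0.
set m := powR x a in m0 *.
have lm : ln m = a * ln x by rewrite ln_powR.
have ln_le z : 0 < z -> 1 + ln z <= z.
  by move=> z0; rewrite -{2}(lnK z0) expR_ge1Dx.
have h1 : 1 + (ln x - ln m) <= x / m.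
  by rewrite -ln_div ?posrE//; apply: ln_le; rewrite divr_gt0.
have h2 : 1 - ln m <= m^-1.
  by rewrite -lnV ?posrE//; apply: ln_le; rewrite invr_gt0.
have : 1 <= a * (x / m) + (1 - a) * m^-1.
  have : a * (1 + (ln x - ln m)) + (1 - a) * (1 - ln m) <= a * (x / m) + (1 - a) * m^-1.
    by rewrite lerD// ler_wpM2l// subr_ge0.
  by apply: le_trans; rewrite lm; lra.
rewrite mulrA -mulrDl ler_pdivlMr//; lra.
Qed.

Lemma powR1D x p : 0 <= x -> 0 <= p -> powR x (1 + p) = x * powR x p.
Proof.
move=> x0 p0; rewrite powRD ?powRr1//.
by apply/implyP => /eqP h; exfalso; lra.
Qed.

(** Bernoulli at 1 / s gives s^(1+a) >= s^2 / D with D = a + (1 - a) s, and s^2 = (1 + (1 + a)(s -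
    1)) D + a^2 (s - 1)^2 exactly. The range s <= 2 serves to have D <= 2, whence the coefficient
    a^2 / 2. *)
Lemma powR1D_lower a s : 0 < a <= 1 -> 0 < s <= 2 ->
  1 + (1 + a) * (s - 1) + a ^+ 2 / 2 * (s - 1) ^+ 2 <= s * powR s a.
Proof.
move=> /andP[a0 a1] /andP[s0 s2].
have A0 : 0 < powR s a by exact: powR_gt0.
have h : 1 <= powR s a * (1 + a * (s^-1 - 1)).
  have := @powR_bernoulli a s^-1; rewrite (ltW a0) a1 invr_ge0 (ltW s0) => /(_ isT isT).
  move=> /(ler_wpM2l (ltW A0)); apply: le_trans.
  by rewrite -powRM ?invr_ge0 ?(ltW s0)// divff ?gt_eqF// powR1.
set A := powR s a in A0 h *.
have h2 : s <= A * (a + (1 - a) * s).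
  have := ler_wpM2l (ltW s0) h; rewrite mulr1 => /le_trans; apply.
  rewrite le_eqVlt; apply/orP; left; apply/eqP.
  by field; rewrite gt_eqF.
set D := a + (1 - a) * s in h2.
have D0 : 0 < D by rewrite /D; nra.
have D2 : D <= 2 by rewrite /D; nra.
have h3 : s ^+ 2 <= s * A * D by rewrite expr2 -mulrA ler_pM2l.
rewrite -(ler_pM2r D0); apply: le_trans h3.
have : a ^+ 2 / 2 * (s - 1) ^+ 2 * D <= a ^+ 2 / 2 * (s - 1) ^+ 2 * 2.
  by rewrite ler_wpM2l// mulr_ge0 ?sqr_ge0// divr_ge0 ?sqr_ge0.
move=> h4; rewrite mulrDl.
have : (1 + (1 + a) * (s - 1)) * D + a ^+ 2 / 2 * (s - 1) ^+ 2 * 2 = s ^+ 2.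
  by rewrite /D; field.
lra.
Qed.

Lemma powR1D_lower_scaled a t t1 : 0 < a <= 1 -> 0 < t1 -> 0 < t <= 2 * t1 ->
  t1 * powR t1 a + (1 + a) * powR t1 a * (t - t1)
   + a ^+ 2 / 2 * (powR t1 a / t1) * (t - t1) ^+ 2 <= t * powR t a.
Proof.
move=> ha t10 /andP[t0 t2].
have s0 : 0 < t / t1 by rewrite divr_gt0.
have -> : t = t / t1 * t1 by rewrite divfK// gt_eqF.
have := @powR1D_lower a (t / t1) ha.
rewrite s0 ler_pdivrMr// => /(_ t2).
move: s0; move: (t / t1) => s s0 h.
rewrite (powRM _ (ltW s0) (ltW t10)).
have p0 : 0 <= powR t1 a * t1 by rewrite mulr_ge0 ?powR_ge0 ?ltW.
have := ler_wpM2l p0 h.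
move: (powR s a) (powR t1 a) => A P.
rewrite (_ : s * t1 * (A * P) = P * t1 * (s * A)); last by ring.
apply: le_trans; rewrite le_eqVlt; apply/orP; left; apply/eqP.
by field; rewrite gt_eqF.
Qed.

(** The power t^(1+a) is a concave function of t^2, so it lies below its tangent in that variable.
    With t = |X| this is a paraboloid in X. *)
Lemma powR1D_upper a t t1 : 0 < a <= 1 -> 0 < t1 -> 0 <= t ->
  t * powR t a <= t1 * powR t1 a + (1 + a) / 2 * (powR t1 a / t1) * (t ^+ 2 - t1 ^+ 2).
Proof.
move=> /andP[a0 a1] t10 t0.
have a1_ge0 : 0 <= 1 + a by lra.
have E z : 0 <= z -> z * powR z a = powR (z ^+ 2) ((1 + a) / 2).
  move=> z0; rewrite -powR1D ?(ltW a0)// -powR_mulrn// -powRrM; congr (powR _ _).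
  by field.
have q0 : 0 < t1 ^+ 2 by rewrite exprn_gt0.
have h := @powR_bernoulli ((1 + a) / 2) (t ^+ 2 / t1 ^+ 2).
have {}h : powR (t ^+ 2 / t1 ^+ 2) ((1 + a) / 2) <= 1 + (1 + a) / 2 * (t ^+ 2 / t1 ^+ 2 - 1).
  by apply: h; [apply/andP; split; lra|rewrite divr_ge0 ?sqr_ge0].
have -> : t * powR t a = powR (t ^+ 2 / t1 ^+ 2) ((1 + a) / 2) * (t1 * powR t1 a).
  rewrite (E t)// (E t1) ?ltW// -powRM ?divr_ge0 ?sqr_ge0//.
  by rewrite divfK// gt_eqF.
have p0 : 0 <= t1 * powR t1 a by rewrite mulr_ge0 ?powR_ge0 ?ltW.
apply: le_trans (ler_wpM2r p0 h) _.
move: (powR t1 a) => P; rewrite le_eqVlt; apply/orP; left; apply/eqP.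
by field; rewrite gt_eqF.
Qed.

(** Monotonicity of s^(a-1), the size of the second derivative of s^(1+a); it serves to compare the
    curvatures of the M and N terms of the barrier. *)
Lemma powR_div_le a s t : a <= 1 -> 0 < s <= t -> powR t a / t <= powR s a / s.
Proof.
move=> a1 /andP[s0 st]; have t0 := lt_le_trans s0 st.
have h : powR (t / s) a <= t / s.
  by apply: ler1_powR => //; rewrite ler_pdivlMr// mul1r.
rewrite ler_pdivrMr// mulrAC -mulrA [X in _ <= _ * X](_ : _ = t / s); last by rewrite mulrC.
have -> : powR t a = powR s a * powR (t / s) a.
  by rewrite -powRM ?ltW ?divr_gt0// mulrCA divff ?mulr1// gt_eqF.
by rewrite ler_wpM2l ?powR_ge0// mulrC.
Qed.

Lemma powR_continuous_at p x : 0 < x -> {for x, continuous (fun s : R => powR s p)}.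
Proof.
move=> x0; apply: differentiable_continuous; apply/derivable1_diffP.
by apply: derivable_powR; rewrite in_itv/= andbT.
Qed.

Lemma powR_comp_continuous (T : topologicalType) (f : T -> R) p (x : T) :
  0 < p -> (forall y, 0 <= f y) -> {for x, continuous f} ->
  {for x, continuous (fun y => powR (f y) p)}.
Proof.
move=> p0 f0 cf; have [fx0|fx0] := ltP 0 (f x).
  by apply: (@continuous_comp _ _ _ f (fun s => powR s p)) => //; exact: powR_continuous_at.
have fx : f x = 0 by apply/eqP; rewrite eq_le fx0 f0.
rewrite /prop_for /continuous_at fx powR0 ?gt_eqF//.
apply/cvgrPdist_lt => e e0.
have d0 : 0 < powR e p^-1 by exact: powR_gt0.
move: cf; rewrite /prop_for /continuous_at fx => /cvgrPdist_lt /(_ _ d0).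
apply: filterS => y; rewrite !sub0r !normrN !ger0_norm ?powR_ge0// => fy.
rewrite -[ltRHS](powRr1 (ltW e0)) -(mulVf (lt0r_neq0 p0)) powRrM.
by rewrite gt0_ltr_powR// nnegrE ?powR_ge0.
Qed.

Lemma powR_le_root a s t : 0 < a -> 0 <= s -> 0 <= t -> s <= powR t a^-1 -> powR s a <= t.
Proof.
move=> a0 s0 t0 st.
have : powR s a <= powR (powR t a^-1) a by rewrite ge0_ler_powR ?nnegrE ?powR_ge0// ltW.
by rewrite -powRrM mulVf ?gt_eqF// powRr1.
Qed.

Lemma powR_ge_exists a (M : R) : 0 < a -> 0 < M ->
  exists2 d, 0 < d & forall s, 0 <= s <= d -> M * powR s a <= 1.
Proof.
move=> a0 M0; exists (powR M^-1 a^-1); first by rewrite powR_gt0// invr_gt0.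
move=> s /andP[s0 sd].
rewrite -ler_pdivlMl// mulr1; apply: powR_le_root => //.
by rewrite invr_ge0 ltW.
Qed.
End Powers.

(** * Holder graphs and the barrier *)

Section Graph.
Context {R : realType} {n : nat}.
Local Notation d := n.+2.
Implicit Types (x : 'rV[R]_d) (y w : 'rV[R]_n.+1).

Definition mkpt y (s : R) : 'rV[R]_d :=
  \row_(i < d) (if (i : nat) == n.+1 then s else y ord0 (inord i)).

Lemma xprime_mkpt y s : xprime (mkpt y s) = y.
Proof.
apply/rowP => i; rewrite !mxE /= ltn_eqF//; congr (y ord0 _).
by apply: val_inj; rewrite /= inordK.
Qed.

Lemma xlast_mkpt y s : xlast (mkpt y s) = s.
Proof. by rewrite /xlast mxE /= eqxx. Qed.

Lemma dotv_split x z : dotv x z = dotv (xprime x) (xprime z) + xlast x * xlast z.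
Proof.
rewrite /dotv big_ord_recr/=; congr (_ + _).
apply: eq_bigr => i _; rewrite !mxE.
by congr (x ord0 _ * z ord0 _); apply: val_inj.
Qed.

Lemma xprimeD x z : xprime (x + z) = xprime x + xprime z.
Proof. by apply/rowP => i; rewrite !mxE. Qed.

Lemma xprimeB x z : xprime (x - z) = xprime x - xprime z.
Proof. by apply/rowP => i; rewrite !mxE. Qed.

Lemma xprimeZ (a : R) x : xprime (a *: x) = a *: xprime x.
Proof. by apply/rowP => i; rewrite !mxE. Qed.

Lemma xlastD x z : xlast (x + z) = xlast x + xlast z.
Proof. by rewrite /xlast mxE. Qed.

Lemma xlastB x z : xlast (x - z) = xlast x - xlast z.
Proof. by rewrite /xlast !mxE. Qed.

Lemma xlastZ (a : R) x : xlast (a *: x) = a * xlast x.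
Proof. by rewrite /xlast mxE. Qed.

Lemma enorm_xprime x : enorm (xprime x) <= enorm x.
Proof.
by rewrite ler_sqrt ?dotv_ge0// (dotv_split x x) lerDl -expr2 sqr_ge0.
Qed.

Lemma xprime_continuous : continuous (@xprime R n).
Proof.
move=> x; apply: enorm_continuous_at => e e0.
have /= := eball_nbhs x e0; apply: filterS => z.
by rewrite /eball/= enormBC -xprimeB; apply: le_lt_trans (enorm_xprime _).
Qed.

Lemma xlast_continuous : continuous (@xlast R n).
Proof. by move=> x; exact: coord_continuous. Qed.

Variables (Psi : 'rV[R]_n.+1 -> R).

Definition height x : R := xlast x - Psi (xprime x).

Lemma derive_grad y v : differentiable Psi y -> 'D_v Psi y = dotv (grad Psi y) v.
Proof.
move=> dy; rewrite deriveE// [in LHS](row_sum_delta v) linear_sum/=.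
by apply: eq_bigr => i _; rewrite linearZ/= mulrC mxE /partial deriveE.
Qed.

Lemma mean_value_segment y w : (forall s, 0 <= s <= 1 -> differentiable Psi (y + s *: (w - y))) ->
  exists2 s, 0 <= s <= 1 & Psi w - Psi y = dotv (grad Psi (y + s *: (w - y))) (w - y).
Proof.
move=> df; set v := w - y in df *.
pose phi (s : R) : R := Psi (y + s *: v).
have E (s h : R) : phi (h *: (1 : R) + s) = Psi (h *: v + (y + s *: v)).
  by rewrite /phi; congr Psi; rewrite scalerDl addrCA [h *: 1]mulr1.
have der (s : R) : 0 <= s <= 1 -> is_derive s (1 : R) phi (dotv (grad Psi (y + s *: v)) v).
  move=> hs; have dd := df _ hs.
  rewrite -derive_grad//.
  have := @diff_derivable _ _ _ _ _ v dd; rewrite /derivable => ex.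
  split; rewrite /derivable /derive; under eq_fun do rewrite /= E; exact: ex || by [].
have [||s sI] := @MVT R phi (fun s => dotv (grad Psi (y + s *: v)) v) 0 1 ltr01.
- by move=> s; rewrite in_itv/= => /andP[/ltW s0 /ltW s1]; apply: der; rewrite s0.
- apply: derivable_within_continuous => s; rewrite in_itv/= => hs.
  by have [] := der s hs.
rewrite subr0 mulr1 /phi scale1r scale0r addr0 /v => e.
rewrite (_ : y + (w - y) = w) in e; last by rewrite addrC subrK.
exists s; last by rewrite -e.
by move: sI; rewrite in_itv/= => /andP[/ltW -> /ltW ->].
Qed.

End Graph.

Section HolderGraph.
Context {R : realType} {n : nat} (alpha K : R) (Psi : 'rV[R]_n.+1 -> R).
Hypothesis alpha0 : 0 <= alpha.
Hypothesis K0 : 0 <= K.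
Hypothesis dPsi : forall y, B1' y -> differentiable Psi y.
Hypothesis hPsi : forall y z, B1' y -> B1' z ->
    enorm (grad Psi y - grad Psi z) <= K * powR (enorm (y - z)) alpha.
Implicit Types (x : 'rV[R]_n.+2) (y w : 'rV[R]_n.+1).

Lemma B1'_segment y w s : B1' y -> B1' w -> 0 <= s <= 1 -> B1' (y + s *: (w - y)).
Proof.
rewrite /B1' /eball/= !subr0 => hy hw /andP[s0 s1].
rewrite (_ : y + _ = (1 - s) *: y + s *: w); last first.
  by rewrite scalerBr scalerBl scale1r addrA addrAC.
apply: le_lt_trans (enormD _ _) _; rewrite !enormZ ger0_norm ?subr_ge0// ger0_norm//.
have [->|s0'] := eqVneq s 0; first by rewrite subr0 mul1r mul0r addr0.
have sp : 0 < s by rewrite lt0r s0' s0.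
have : (1 - s) * enorm y <= (1 - s) * 1 by rewrite ler_wpM2l ?subr_ge0// ltW.
have : s * enorm w < s * 1 by rewrite ltr_pM2l.
lra.
Qed.

Lemma taylor_Psi y w : B1' y -> B1' w ->
  `|Psi w - Psi y - dotv (grad Psi y) (w - y)| <= K * (enorm (w - y) * powR (enorm (w - y)) alpha).
Proof.
move=> hy hw.
have [s /andP[s0 s1] ->] := @mean_value_segment R n Psi y w
  (fun s hs => dPsi (B1'_segment hy hw hs)).
have hs : B1' (y + s *: (w - y)) by apply: B1'_segment => //; rewrite s0.
rewrite -dotvBl; apply: le_trans (cauchy_schwarz _ _) _.
rewrite [X in _ <= _ * X]mulrC mulrA ler_wpM2r//.
apply: le_trans (hPsi hs hy) _; rewrite ler_wpM2l//.
rewrite addrC addKr enormZ ger0_norm// ge0_ler_powR ?nnegrE ?mulr_ge0//.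
by rewrite ler_piMl.
Qed.

Lemma grad_Psi_bounded : exists2 L, 0 <= L & forall y, B1' y -> enorm (grad Psi y) <= L.
Proof.
have B0 : B1' (0 : 'rV[R]_n.+1) by rewrite /B1' /eball/= subr0 enorm0.
exists (enorm (grad Psi 0) + K); first by rewrite addr_ge0.
move=> y hy; have := enormD (grad Psi y - grad Psi 0) (grad Psi 0).
rewrite subrK addrC => /le_trans; apply; rewrite lerD2l.
apply: le_trans (hPsi hy B0) _; rewrite -[X in _ <= X]mulr1 ler_wpM2l// subr0.
rewrite (_ : 1 = powR (1 : R) alpha); last by rewrite powR1.
rewrite ge0_ler_powR ?nnegrE//.
by move: hy; rewrite /B1' /eball/= subr0 => /ltW.
Qed.

Lemma grad_Psi_continuous y : 0 < alpha -> B1' y -> {for y, continuous (grad Psi)}.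
Proof.
move=> a0 hy; apply: enorm_continuous_at => e e0.
have ek : 0 < e / (K + 1) by rewrite divr_gt0// ltr_wpDl.
have d0 : 0 < powR (e / (K + 1)) alpha^-1 by exact: powR_gt0.
have By : 0 < 1 - enorm y by move: hy; rewrite /B1' /eball/= subr0; lra.
near=> z.
have hz : B1' z.
  rewrite /B1' /eball/= subr0.
  have := enormD y (z - y); rewrite addrC subrK.
  have : enorm (z - y) < 1 - enorm y by near: z; exact: (eball_nbhs y By).
  lra.
have zd : enorm (y - z) < powR (e / (K + 1)) alpha^-1.
  by rewrite enormBC; near: z; exact: (eball_nbhs y d0).
apply: le_lt_trans (hPsi hy hz) _.
have : powR (enorm (y - z)) alpha <= e / (K + 1).
  by apply: powR_le_root => //; exact: ltW.
move=> /(ler_wpM2l K0)/le_lt_trans; apply.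
rewrite mulrCA gtr_pMr// ltr_pdivrMr ?ltr_wpDl//; lra.
Unshelve. all: by end_near. Qed.

End HolderGraph.

Section BarrierArith.
Context {R : realType}.

Lemma kink_arith (t q M N Q : R) : N * q <= M * q -> Q * t * t <= 2^-1 * t ->
  - t - M * q + N * q + Q * t ^+ 2 <= - (t / 2).
Proof. lra. Qed.

(** The final arithmetic of [barrier_touch]. There [pT] = T1^al, [P] = T1^(al-1), [P'] = r1^(al-1),
    [tp] and [ep] are the powers 1 + al of T and |X|, [rp] that of r1, [r2] = r1^2, and [nv], [Xv],
    [vv] are the products of x - x1 with the normal, with X1 and with itself. *)
Lemma touch_arith (M N Q al pT T1 P P' nv Xv vv tp ep rp r2 : R) :
  M * (T1 * pT + (1 + al) * pT * nv + al ^+ 2 / 2 * P * nv ^+ 2) <= M * tp ->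
  N * ep <= N * (rp + (1 + al) / 2 * P' * (r2 + 2 * Xv + vv - r2)) ->
  - (T1 + nv) - M * tp + N * ep + Q * (r2 + 2 * Xv + vv) <=
  - T1 - M * (T1 * pT) + N * rp + Q * r2 -
  ((1 + M * (1 + al) * pT) * nv - (N * (1 + al) * P' + 2 * Q) * Xv +
   2^-1 * (M * al ^+ 2 * P * nv ^+ 2 - (N * (1 + al) * P' + 2 * Q) * vv)).
Proof. lra. Qed.

End BarrierArith.

Section Barrier.
Context {R : realType} {n : nat}.
Local Notation d := n.+2.
Variables (lam Lam alpha K L : R) (Psi : 'rV[R]_n.+1 -> R).
Hypothesis lam0 : 0 < lam.
Hypothesis lamLam : lam <= Lam.
Hypothesis alpha01 : 0 < alpha <= 1.
Hypothesis K0 : 0 <= K.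
Hypothesis L0 : 0 <= L.
Hypothesis dPsi : forall y, B1' y -> differentiable Psi y.
Hypothesis hPsi : forall y z, B1' y -> B1' z ->
    enorm (grad Psi y - grad Psi z) <= K * powR (enorm (y - z)) alpha.
Hypothesis hL : forall y, B1' y -> enorm (grad Psi y) <= L.
Implicit Types (x : 'rV[R]_d) (y w : 'rV[R]_n.+1).

Definition zpt y : 'rV[R]_d := mkpt y (Psi y).
(* [nvec y] is an unnormalized normal to Gamma at [zpt y], and [tilt y] the height above the tangent plane there. *)
Definition nvec y : 'rV[R]_d := mkpt (- grad Psi y) 1.
Definition tilt y x : R := dotv (nvec y) (x - zpt y).

Lemma tiltE y x : tilt y x =
  height Psi x + (Psi (xprime x) - Psi y - dotv (grad Psi y) (xprime x - y)).
Proof.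
rewrite /tilt /nvec /zpt dotv_split xprimeB xlastB !xprime_mkpt !xlast_mkpt dotvNl /height.
ring.
Qed.

Lemma nvec_sq y : dotv (nvec y) (nvec y) = enorm (grad Psi y) ^+ 2 + 1.
Proof.
by rewrite dotv_split !xprime_mkpt !xlast_mkpt mulr1 dotvNl dotvNr opprK sqr_enorm.
Qed.

Lemma tilt_le y x : B1' y -> tilt y x <= (1 + L) * enorm (x - zpt y).
Proof.
move=> hy; apply: le_trans (dotv_le _ _) _; rewrite ler_wpM2r//.
have L1 : 0 <= 1 + L by rewrite addr_ge0.
rewrite -(ler_pXn2r (_ : (0 < 2)%N)) ?nnegrE//.
rewrite sqr_enorm nvec_sq; have := hL hy; have := enorm_ge0 (grad Psi y).
move: (enorm _) => g; nra.
Qed.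

Lemma tilt_height y x : B1' y -> B1' (xprime x) ->
  tilt y x <= height Psi x + K * (enorm (x - zpt y) * powR (enorm (x - zpt y)) alpha).
Proof.
move=> hy hx; have /andP[a0 _] := alpha01.
rewrite tiltE lerD2l.
have := taylor_Psi (ltW a0) K0 dPsi hPsi hy hx; rewrite ler_norml => /andP[_ h].
apply: le_trans h _; rewrite ler_wpM2l//.
have hr : enorm (xprime x - y) <= enorm (x - zpt y).
  by apply: le_trans (enorm_xprime _); rewrite xprimeB xprime_mkpt.
by rewrite ler_pM ?powR_ge0// ge0_ler_powR ?nnegrE// ltW.
Qed.

(* The term in M makes the Pucci operator of [- barrier] large, the term in N absorbs the C^{1,alpha}
   deviation of Gamma from its tangent plane, and the term in Q confines {barrier < 0} to a small ball. *)
Definition barrier (M N Q : R) y x : R :=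
  - tilt y x - M * (Num.max (tilt y x) 0 * powR (Num.max (tilt y x) 0) alpha)
  + N * (enorm (x - zpt y) * powR (enorm (x - zpt y)) alpha)
  + Q * enorm (x - zpt y) ^+ 2.

Section Estimates.
Variables (M N Q delta0 : R).
Hypothesis N0 : 0 <= N.
Hypothesis NK : 2 * K <= N.
Hypothesis MN : N <= M.
Hypothesis M0 : 0 < M.
Hypothesis Mbig : 2 * Lam * d%:R * N * (1 + L) <= lam * M * alpha ^+ 2.
Hypothesis delta00 : 0 < delta0.
Hypothesis Mdelta : forall s, 0 <= s <= (1 + L) * delta0 -> M * powR s alpha <= 1.
Hypothesis Qbig : M * (1 + L) ^+ 2 + (1 + L + M * (1 + L)) / delta0 <= Q.

Let L1 : 1 <= 1 + L. Proof. by rewrite lerDl. Qed.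
Let Q0 : 0 <= Q.
Proof.
apply: le_trans Qbig; have := L1; have := M0 => m0 l1.
apply: addr_ge0; first by apply: mulr_ge0; [exact: ltW|exact: sqr_ge0].
by apply: divr_ge0; [nra|exact: ltW].
Qed.

(** For T <= 0 every term is nonnegative. For |X| >= delta0 the Q term wins: T <= (1 + L)|X| and
    T^alpha <= 1 + T bound T + M T^(1+alpha) by a linear plus a quadratic expression in |X|, and the
    linear part is at most its coefficient times |X|^2 / delta0. [Qbig] is the sum of the two
    coefficients. *)
Lemma barrier_neg y x : B1' y -> barrier M N Q y x < 0 ->
  0 < tilt y x /\ enorm (x - zpt y) < delta0.
Proof.
move=> hy; rewrite /barrier; set T := tilt y x; set r := enorm _.
have /andP[a0 a1] := alpha01.
have r0 : 0 <= r by exact: enorm_ge0.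
have h1 : 0 <= N * (r * powR r alpha) by rewrite mulr_ge0// mulr_ge0// powR_ge0.
have h2 : 0 <= Q * r ^+ 2 by rewrite mulr_ge0 ?sqr_ge0.
have [T0|T0] := leP T 0; first by rewrite mul0r mulr0; lra.
move=> neg; split => //; rewrite ltNge; apply/negP => rd.
have Tr : T <= (1 + L) * r by exact: tilt_le.
have hp : T * powR T alpha <= (1 + L) * r * (1 + (1 + L) * r).
  have cr0 : 0 <= (1 + L) * r by rewrite mulr_ge0//; exact: le_trans L1.
  apply: ler_pM; rewrite ?powR_ge0 ?(ltW T0)//.
  have : powR T alpha <= 1 + alpha * (T - 1).
    by apply: powR_bernoulli; rewrite ?(ltW a0) ?(ltW T0).
  move=> /le_trans; apply; nra.
have := ler_wpM2l (ltW M0) hp.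
have q2 : (M * (1 + L) ^+ 2 + (1 + L + M * (1 + L)) / delta0) * r ^+ 2 <= Q * r ^+ 2.
  by rewrite ler_wpM2r// sqr_ge0.
have q3 : (1 + L + M * (1 + L)) * r <= (1 + L + M * (1 + L)) / delta0 * r ^+ 2.
  have cM : 0 <= 1 + L + M * (1 + L) by have := M0; have := L1; nra.
  have : r <= r ^+ 2 / delta0 by rewrite ler_pdivlMr// expr2 ler_wpM2l.
  by move=> /(ler_wpM2l cM)/le_trans; apply; rewrite mulrA mulrAC.
nra.
Qed.

(** Where B < 0, T is at most (1 + L) delta0, so M T^alpha <= 1 and the two negative terms amount to
    at most 2 T. *)
Lemma barrier_lower y x : B1' y -> - (2 * ((1 + L) * delta0)) <= barrier M N Q y x.
Proof.
move=> hy; have [B0|] := leP 0 (barrier M N Q y x).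
  apply: le_trans B0; rewrite oppr_le0 !mulr_ge0//; last exact: ltW.
  exact: le_trans L1.
move=> /(barrier_neg hy)[T0 rd]; rewrite /barrier; have /andP[a0 a1] := alpha01.
have Tr := tilt_le x hy.
have r0 : 0 <= enorm (x - zpt y) by exact: enorm_ge0.
have h1 : 0 <= N * (enorm (x - zpt y) * powR (enorm (x - zpt y)) alpha).
  by rewrite mulr_ge0// mulr_ge0// powR_ge0.
have h2 : 0 <= Q * enorm (x - zpt y) ^+ 2 by rewrite mulr_ge0 ?sqr_ge0.
have Td : tilt y x <= (1 + L) * delta0.
  by apply: le_trans Tr _; rewrite ler_wpM2l ?(ltW rd)//; exact: le_trans L1.
have mx : Num.max (tilt y x) 0 = tilt y x by apply/max_idPl; exact: ltW.
rewrite mx.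
have : M * powR (tilt y x) alpha <= 1 by apply: Mdelta; rewrite (ltW T0).
move=> /(ler_wpM2l (ltW T0)); rewrite mulr1 mulrCA; lra.
Qed.

(** On and below Gamma, T <= K |X|^(1+alpha). If B were negative, then M T^alpha <= 1, and T + M
    T^(1+alpha) <= 2 T <= 2 K |X|^(1+alpha) would be absorbed by the N term. *)
Lemma barrier_interface y x : B1' y -> B1' (xprime x) -> height Psi x <= 0 ->
  0 <= barrier M N Q y x.
Proof.
move=> hy hx ht; rewrite leNgt; apply/negP => neg.
have [T0 rd] := barrier_neg hy neg; move: neg; rewrite /barrier ltNge => /negP; apply.
have /andP[a0 a1] := alpha01.
have Tr := tilt_le x hy.
have Td : tilt y x <= (1 + L) * delta0.
  by apply: le_trans Tr _; rewrite ler_wpM2l ?(ltW rd)//; exact: le_trans L1.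
have h2 : 0 <= Q * enorm (x - zpt y) ^+ 2 by rewrite mulr_ge0 ?sqr_ge0.
have mx : Num.max (tilt y x) 0 = tilt y x by apply/max_idPl; exact: ltW.
rewrite mx.
have : M * powR (tilt y x) alpha <= 1 by apply: Mdelta; rewrite (ltW T0).
move=> /(ler_wpM2l (ltW T0)); rewrite mulr1 mulrCA => h3.
have := tilt_height hy hx.
set q := enorm _ * powR _ _.
have q0 : 0 <= q by rewrite mulr_ge0// powR_ge0.
have : 2 * K * q <= N * q by rewrite ler_wpM2r.
lra.
Qed.

(** For y = x' the vector X is vertical and T = |X| is the height, so N <= M disposes of the two
    powers 1 + alpha. *)
Lemma barrier_kink x : 0 <= height Psi x -> Q * height Psi x <= 2^-1 ->
  barrier M N Q (xprime x) x <= - (height Psi x / 2).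
Proof.
move=> t0 Qt; rewrite /barrier.
have -> : tilt (xprime x) x = height Psi x.
  by rewrite tiltE !subrr dotv0r subrr addr0.
have -> : enorm (x - zpt (xprime x)) = height Psi x.
  rewrite /enorm dotv_split xprimeB xlastB xprime_mkpt xlast_mkpt subrr dotv0l add0r.
  by rewrite -expr2 sqrtr_sqr ger0_norm.
have -> : Num.max (height Psi x) 0 = height Psi x by apply/max_idPl.
set q := _ * powR _ _.
have q0 : 0 <= q by rewrite mulr_ge0// powR_ge0.
have h1 := ler_wpM2r q0 MN.
have h2 := ler_wpM2r t0 Qt.
exact: kink_arith.
Qed.

Lemma tilt_affine y x x1 : tilt y x = tilt y x1 + dotv (nvec y) (x - x1).
Proof. by rewrite /tilt !dotvE; ring. Qed.

(** Expand the M term by [powR1D_lower_scaled] and the N term by [powR1D_upper]. Both resulting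
    curvatures [gam] and [kap] blow up near the base point, but since T1 <= (1 + L) r1 the blow-up
    of [kap] is dominated by that of [gam], and [Mbig] makes the ellipticity constants come out
    right. Only the part 2 Q of [kap] survives. *)
Lemma barrier_touch y x1 : B1' y -> barrier M N Q y x1 < 0 ->
  exists b gam kap, [/\ 0 <= gam, 0 <= kap,
    - (2 * Lam * d%:R * Q) <= lam * (gam * dotv (nvec y) (nvec y)) - Lam * (d%:R * kap) &
    \forall x \near x1, barrier M N Q y x <= barrier M N Q y x1 - (dotv b (x - x1)
       + 2^-1 * (gam * dotv (nvec y) (x - x1) ^+ 2 - kap * dotv (x - x1) (x - x1)))].
Proof.
move=> hy neg; have [T10 rd] := barrier_neg hy neg.
have /andP[a0 a1] := alpha01.
set T1 := tilt y x1 in T10; set X1 := x1 - zpt y; set r1 := enorm X1.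
have r10 : 0 < r1.
  rewrite lt0r enorm_ge0 andbT; apply/eqP => /enorm_eq0 h.
  by move: T10; rewrite /T1 /tilt -/X1 h dotv0r ltxx.
have Tr : T1 <= (1 + L) * r1 by exact: tilt_le.
pose P := powR T1 alpha / T1; pose P' := powR r1 alpha / r1.
have P0 : 0 <= P by rewrite divr_ge0 ?powR_ge0 ?ltW.
have P'0 : 0 <= P' by rewrite divr_ge0 ?powR_ge0 ?ltW.
have L10 : 0 < 1 + L by apply: lt_le_trans L1.
have PP : P' <= (1 + L) * P.
  have : P' <= powR (T1 / (1 + L)) alpha / (T1 / (1 + L)).
    by apply: powR_div_le => //; rewrite divr_gt0//= ler_pdivrMr// mulrC.
  move=> /le_trans; apply; rewrite /P invfM invrK mulrCA mulrC mulrAC.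
  rewrite [X in X <= _]mulrC ler_pM2l// ler_pM2r ?invr_gt0//.
  rewrite ge0_ler_powR ?nnegrE ?divr_ge0 ?(ltW T10) ?(ltW L10) ?(ltW a0)//.
  by rewrite ler_pdivrMr// ler_peMr// ltW.
pose gam := M * alpha ^+ 2 * P.
pose kap := N * (1 + alpha) * P' + 2 * Q.
pose b := (1 + M * (1 + alpha) * powR T1 alpha) *: nvec y - kap *: X1.
have gam0 : 0 <= gam.
  by apply: mulr_ge0 => //; apply: mulr_ge0; [exact: ltW|exact: sqr_ge0].
have kap0 : 0 <= kap.
  have a2 : 0 <= 1 + alpha by lra.
  by apply: addr_ge0; apply: mulr_ge0 => //; apply: mulr_ge0.
exists b, gam, kap; split => //.
  have kle : kap <= 2 * N * (1 + L) * P + 2 * Q.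
    have h : (1 + alpha) * P' <= 2 * ((1 + L) * P) by apply: ler_pM => //; lra.
    by have := ler_wpM2l N0 h; rewrite /kap; lra.
  have nn : 1 <= dotv (nvec y) (nvec y) by rewrite nvec_sq lerDr sqr_ge0.
  have g1 : lam * gam <= lam * (gam * dotv (nvec y) (nvec y)).
    by rewrite ler_wpM2l ?(ltW lam0)// ler_peMr.
  have ld0 : 0 <= Lam * d%:R by rewrite mulr_ge0// (le_trans (ltW lam0)).
  have := ler_wpM2l ld0 kle.
  have := ler_wpM2r P0 Mbig.
  move: g1; rewrite /gam; lra.
have cT : {for x1, continuous (tilt y)}.
  apply: dotv_continuous; first exact: cst_continuous.
  by apply: continuousB => //; exact: cst_continuous.
have near1 : \forall x \near x1, 0 < tilt y x.
  exact: (cT _ (lt_nbhsr T10)).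
(* The lower expansion of the power holds only up to twice the base value. *)
have near2 : \forall x \near x1, tilt y x < 2 * T1.
  have T12 : T1 < 2 * T1 by lra.
  exact: (cT _ (lt_nbhsl T12)).
near=> x.
have T0 : 0 < tilt y x by near: x.
have T2 : tilt y x <= 2 * T1 by apply: ltW; near: x.
have mx (z : R) : 0 < z -> Num.max z 0 = z by move=> z0; apply/max_idPl; exact: ltW.
rewrite /barrier -/T1 -/X1 -/r1 !mx//.
have hT : tilt y x = T1 + dotv (nvec y) (x - x1) by exact: tilt_affine.
have hX : enorm (x - zpt y) ^+ 2 = r1 ^+ 2 + 2 * dotv X1 (x - x1) + dotv (x - x1) (x - x1).
  rewrite /r1 !sqr_enorm /X1 (_ : x - zpt y = (x1 - zpt y) + (x - x1)); last first.
    by rewrite [RHS]addrC addrA subrK.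
  by rewrite dotvDl !(dotvDr (x1 - zpt y)) (dotvC (x - x1) (x1 - zpt y)); ring.
have ha : 0 < alpha <= 1 by rewrite a0.
have T0' : 0 < tilt y x <= 2 * T1 by rewrite T0.
have low := powR1D_lower_scaled ha T10 T0'.
have up := powR1D_upper ha r10 (enorm_ge0 (x - zpt y)).
have hT' : tilt y x - T1 = dotv (nvec y) (x - x1) by rewrite hT addrAC subrr add0r.
rewrite hT' -/P in low.
move: up; rewrite hX -/P' => up.
have hb : dotv b (x - x1) =
    (1 + M * (1 + alpha) * powR T1 alpha) * dotv (nvec y) (x - x1) - kap * dotv X1 (x - x1).
  by rewrite /b dotvBl !dotvZl.
have {}low := ler_wpM2l (ltW M0) low; have {}up := ler_wpM2l N0 up.
rewrite hb /gam /kap.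
by rewrite {1}hT; exact: touch_arith.
Unshelve. all: by end_near. Qed.

Lemma barrier_continuous (D : topologicalType) (f : D -> 'rV[R]_n.+1) (g : D -> 'rV[R]_d) (p : D) :
  {for p, continuous f} -> {for p, continuous (Psi \o f)} ->
  {for p, continuous (grad Psi \o f)} -> {for p, continuous g} ->
  {for p, continuous (fun q => barrier M N Q (f q) (g q))}.
Proof.
move=> cf cP cG cg; have /andP[a0 _] := alpha01.
have cmk (h : D -> 'rV[R]_n.+1) (s : D -> R) : {for p, continuous h} ->
    {for p, continuous s} -> {for p, continuous (fun q => mkpt (h q) (s q))}.
  move=> ch cs; apply: enorm_continuous_at => e e0.
  have e2 : 0 < e / 2 by rewrite divr_gt0.
  near=> q.
  have h1 : enorm (h p - h q) < e / 2.
    by rewrite enormBC; near: q; exact: (ch _ (eball_nbhs (h p) e2)).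
  have h2 : `|s p - s q| < e / 2.
    by near: q; move: cs => /cvgrPdist_lt; exact.
  have E : mkpt (h p) (s p) - mkpt (h q) (s q) = mkpt (h p - h q) (s p - s q).
    by apply/rowP => i; rewrite !mxE; case: ifP.
  rewrite E; apply: (@le_lt_trans _ _ (enorm (h p - h q) + `|s p - s q|)); last lra.
  rewrite -(ler_pXn2r (_ : (0 < 2)%N)) ?nnegrE ?addr_ge0// sqr_enorm dotv_split.
  rewrite xprime_mkpt xlast_mkpt -sqr_enorm -expr2 -(real_normK (num_real (s p - s q))).
  by rewrite sqrrD lerD2r lerDl mulrn_wge0// mulr_ge0.
have cz : {for p, continuous (fun q => g q - zpt (f q))}.
  by apply: continuousB => //; exact: cmk.
have cn : {for p, continuous (fun q => nvec (f q))}.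
  by apply: cmk; [apply: continuousN|exact: cst_continuous].
have cT : {for p, continuous (fun q => tilt (f q) (g q))} by exact: dotv_continuous.
have cE : {for p, continuous (fun q => enorm (g q - zpt (f q)))} by exact: enorm_continuous.
have cm : {for p, continuous (fun q => Num.max (tilt (f q) (g q)) 0)}.
  by apply: continuous_max => //; exact: cst_continuous.
have pow (h : D -> R) : (forall q, 0 <= h q) -> {for p, continuous h} ->
    {for p, continuous (fun q => h q * powR (h q) alpha)}.
  by move=> h0 ch; apply: (continuousM ch); exact: powR_comp_continuous.
have m0 q : 0 <= Num.max (tilt (f q) (g q)) 0 by rewrite le_max lexx orbT.
have e0 q : 0 <= enorm (g q - zpt (f q)) by [].
exact: (cvgD (cvgD (cvgB (cvgN cT) (cvgM (cvg_cst M) (pow _ m0 cm)))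
  (cvgM (cvg_cst N) (pow _ e0 cE))) (cvgM (cvg_cst Q) (cvgM cE cE))).
Unshelve. all: by end_near. Qed.

End Estimates.
End Barrier.

Section BarrierExists.
Context {R : realType} {n : nat}.
Local Notation d := n.+2.
Implicit Types (Psi : 'rV[R]_n.+1 -> R).

(** All that the contact argument uses of the barrier. [barrier_above] encodes M^-(D^2 (-B)) >= - C
    by an explicit paraboloid, which can be added to a quadratic test function. *)
Record is_barrier (lam Lam : R) Psi (C cB : R) (B : 'rV[R]_n.+1 -> 'rV[R]_d -> R) : Prop := {
  barrier_bounded : forall y x, B1' y -> - cB <= B y x;
  barrier_ge0 : forall y x, B1' y -> B1' (xprime x) -> height Psi x <= 0 -> 0 <= B y x;
  barrier_decay : exists2 t0, 0 < t0 & forall x, B1' (xprime x) ->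
    0 <= height Psi x <= t0 -> B (xprime x) x <= - (height Psi x / 2);
  barrier_above : forall y x1, B1' y -> B y x1 < 0 ->
    exists b e gam kap, [/\ 0 <= gam, 0 <= kap,
      - C <= lam * (gam * dotv e e) - Lam * (d%:R * kap) &
      \forall x \near x1, B y x <= B y x1 - (dotv b (x - x1)
        + 2^-1 * (gam * dotv e (x - x1) ^+ 2 - kap * dotv (x - x1) (x - x1)))];
  barrier_cont : forall (D : topologicalType) (f : D -> 'rV[R]_n.+1) (g : D -> 'rV[R]_d) (p : D),
    B1' (f p) -> {for p, continuous f} -> {for p, continuous g} ->
    {for p, continuous (fun q => B (f q) (g q))} }.

(** The constants are chosen in the order N, M, delta0, Q, each depending only on the previous ones
    and on the data. *)
Lemma barrier_exists (lam Lam alpha : R) Psi : 0 < lam -> lam <= Lam -> 0 < alpha < 1 ->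
  C1alpha_B1' alpha Psi ->
  exists C cB B, [/\ 0 <= C, 0 <= cB & is_barrier lam Lam Psi C cB B].
Proof.
move=> lam0 lL /andP[a0 /ltW a1] [dP [K0 hK0]].
pose K := Num.max K0 0.
have K_ge0 : 0 <= K by rewrite le_max lexx orbT.
have hP y z : B1' y -> B1' z -> enorm (grad Psi y - grad Psi z) <= K * powR (enorm (y - z)) alpha.
  move=> hy hz; apply: le_trans (hK0 _ _ hy hz) _.
  by rewrite ler_wpM2r ?powR_ge0// le_max lexx.
have [L L_ge0 hL] := grad_Psi_bounded (ltW a0) K_ge0 hP.
have Lam0 : 0 < Lam by exact: lt_le_trans lL.
pose N := 2 * K.
have N_ge0 : 0 <= N by rewrite mulr_ge0.
pose M := 1 + N + 2 * Lam * d%:R * N * (1 + L) / (lam * alpha ^+ 2).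
have la0 : 0 < lam * alpha ^+ 2 by rewrite mulr_gt0// exprn_gt0.
have q0 : 0 <= 2 * Lam * d%:R * N * (1 + L).
  by rewrite !mulr_ge0 ?addr_ge0// ltW.
have q1 : 0 <= 2 * Lam * d%:R * N * (1 + L) / (lam * alpha ^+ 2).
  by rewrite divr_ge0// ltW.
have MN : N <= M by rewrite /M; lra.
have M_gt0 : 0 < M by rewrite /M; lra.
have Mbig : 2 * Lam * d%:R * N * (1 + L) <= lam * M * alpha ^+ 2.
  rewrite (_ : lam * M * alpha ^+ 2 = M * (lam * alpha ^+ 2)); last by ring.
  by rewrite -ler_pdivrMr// /M; lra.
have [dd dd0 hdd] := @powR_ge_exists R alpha M a0 M_gt0.
pose delta0 := dd / (1 + L).
have L1 : 0 < 1 + L by rewrite ltr_pwDl.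
have delta0_gt0 : 0 < delta0 by rewrite divr_gt0.
have Mdelta (s : R) : 0 <= s <= (1 + L) * delta0 -> M * powR s alpha <= 1.
  by rewrite /delta0 mulrC divfK ?gt_eqF//; exact: hdd.
pose Q := M * (1 + L) ^+ 2 + (1 + L + M * (1 + L)) / delta0.
have Q_gt0 : 0 < Q.
  apply: ltr_wpDl; first by apply: mulr_ge0; [exact: ltW|exact: sqr_ge0].
  by apply: divr_gt0 => //; rewrite addr_gt0// mulr_gt0.
have a01 : 0 < alpha <= 1 by rewrite a0.
have QQ : Q <= Q by [].
exists (2 * Lam * d%:R * Q), (2 * ((1 + L) * delta0)), (barrier alpha Psi M N Q).
split.
- by rewrite !mulr_ge0 ?(ltW Lam0) ?(ltW Q_gt0).
- by apply: mulr_ge0 => //; apply: mulr_ge0; exact: ltW.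
split.
- by move=> y x hy; apply: (barrier_lower a01 L_ge0 hL N_ge0 M_gt0 delta0_gt0 Mdelta QQ).
- by move=> y x hy hx ht; apply: (barrier_interface a01 K_ge0 L_ge0 dP hP hL N_ge0 (lexx N) M_gt0 delta0_gt0 Mdelta QQ).
- exists ((2 * Q)^-1); first by rewrite invr_gt0 mulr_gt0.
  move=> x _ /andP[t0 t1]; apply: barrier_kink => //.
  by rewrite -ler_pdivlMl// -invfM mulrC.
- move=> y x1 hy neg.
  have [b [gam [kap [h1 h2 h3 h4]]]] := barrier_touch lam0 lL a01 L_ge0 hL N_ge0 M_gt0
    Mbig delta0_gt0 QQ hy neg.
  by exists b, (nvec Psi y), gam, kap; split.
- move=> D f g p hf cf cg; apply: (barrier_continuous a01); [exact: cf| | |exact: cg].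
    by apply: continuous_comp => //; apply: differentiable_continuous; exact: dP.
  by apply: continuous_comp => //; apply: (grad_Psi_continuous K_ge0 hP).
Qed.
End BarrierExists.

(** * Contact points *)

Section Contact.
Context {R : realType} {n : nat}.
Local Notation d := n.+2.
Variables (lam Lam C cB : R) (Psi : 'rV[R]_n.+1 -> R) (a : 'rV[R]_d -> R)
  (B : 'rV[R]_n.+1 -> 'rV[R]_d -> R).
Hypothesis lam0 : 0 < lam.
Hypothesis lamLam : lam <= Lam.
Hypothesis hB : is_barrier lam Lam Psi C cB B.
Variables (u : 'rV[R]_d -> R) (G rho : R).
Hypothesis C0 : 0 <= C.
Hypothesis G0 : 0 <= G.
Hypothesis cu : continuous u.
Hypothesis rho1 : rho < 1.

(** The base points y range over a compact part of B_1', since the barrier is controlled and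
    continuous only over the open ball. *)
Let Kball : set 'rV[R]_n.+1 := ecball 0 rho.

Definition perturbed y x : R := u x + G * Num.min 0 (B y x).

Definition contact (p x0 : 'rV[R]_d) (y0 : 'rV[R]_n.+1) : Prop :=
  [/\ cB1 x0, Kball y0 & forall x y, cB1 x -> Kball y ->
    perturbed y0 x0 - dotv p x0 <= perturbed y x - dotv p x].

Let KB1' y : Kball y -> B1' y.
Proof. by rewrite /Kball /ecball /B1' /eball/= => /le_lt_trans; apply. Qed.

Lemma perturbed_le y x : perturbed y x <= u x.
Proof. by rewrite gerDl mulr_ge0_le0// ge_min lexx. Qed.

Lemma perturbed_ge y x : B1' y -> 0 <= cB -> u x - G * cB <= perturbed y x.
Proof.
move=> hy c0; rewrite lerD2l -mulrN ler_wpM2l// le_min oppr_le0 c0.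
exact: (barrier_bounded hB).
Qed.

Lemma perturbed_continuous (D : topologicalType) (f : D -> 'rV[R]_n.+1) (g : D -> 'rV[R]_d) (p : D) :
  B1' (f p) -> {for p, continuous f} -> {for p, continuous g} ->
  {for p, continuous (fun q => perturbed (f q) (g q))}.
Proof.
move=> hf cf cg.
have c1 : {for p, continuous (fun q => B (f q) (g q))} by exact: (barrier_cont hB).
have c2 : {for p, continuous (fun q => Num.min 0 (B (f q) (g q)))}.
  by apply: continuous_min => //; exact: cst_continuous.
have c3 : {for p, continuous (fun q => u (g q))}.
  by apply: (@continuous_comp _ _ _ g u) => //; exact: cu.
exact: (cvgD c3 (cvgM (cvg_cst G) c2)).
Qed.

Lemma perturbed_min (Z : set 'rV[R]_d) (q : 'rV[R]_d -> R) : 0 <= rho ->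
  compact Z -> Z !=set0 -> continuous q ->
  exists x0 y0, [/\ Z x0, Kball y0 & forall x y, Z x -> Kball y ->
    perturbed y0 x0 - q x0 <= perturbed y x - q x].
Proof.
move=> rho0 cZ [z Zz] cq.
have cK : compact (Z `*` Kball) by apply: compact_setX => //; exact: ecball_compact.
have [||[x0 y0] /= h1 h2] :=
    @compact_EVT_min _ R (fun xy : 'rV[R]_d * 'rV[R]_n.+1 => perturbed xy.2 xy.1 - q xy.1) _ _ cK.
- by exists (z, 0); split => //=; rewrite /Kball /ecball/= subr0 enorm0.
- apply: continuous_in_subspaceT => -[x y]; rewrite inE => -[/= Zx Ky].
  have c1 : {for (x, y), continuous (fun xy : 'rV[R]_d * 'rV[R]_n.+1 => perturbed xy.2 xy.1)}.
    apply: (@perturbed_continuous _ snd fst (x, y)) => /=.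
    + exact: KB1'.
    + exact: cvg_snd.
    + exact: cvg_fst.
  have c2 : {for (x, y), continuous (fun xy : 'rV[R]_d * 'rV[R]_n.+1 => q xy.1)}.
    by apply: (@continuous_comp _ _ _ fst q); [exact: cvg_fst|exact: cq].
  exact: (cvgB c1 c2).
exists x0, y0; move: h1; rewrite inE => -[/= hx hy]; split => // x y Zx Ky.
by apply: (h2 (x, y)); rewrite inE.
Qed.

(* The barrier is replaced by its touching paraboloid, so only quadratic test functions are needed. *)
Lemma contact_bulk Omega (f : 'rV[R]_d -> R) x2 y2 (b e : 'rV[R]_d) (al be : R) :
  visc_super_bulk lam Lam Psi a Omega f u -> Omega x2 -> Kball y2 ->
  0 <= al -> 0 <= be ->
  (\forall x \near x2, cB1 x -> perturbed y2 x2 + dotv b (x - x2)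
     + 2^-1 * (al * dotv e (x - x2) ^+ 2 - be * dotv (x - x2) (x - x2)) <= perturbed y2 x) ->
  omega Psi a x2 * (lam * (al * dotv e e) - Lam * (d%:R * be) - G * C) <= f x2.
Proof.
move=> visc Ox Ky al0 be0 min2.
have Lam0 : 0 <= Lam by rewrite (le_trans (ltW lam0)).
have touch c b' gam kap e' : 0 <= gam -> 0 <= kap ->
    - (G * C) <= lam * (gam * dotv e' e') - Lam * (d%:R * kap) ->
    c = u x2 -> (\forall x \near x2, cB1 x -> c + dotv b' (x - x2)
     + 2^-1 * (al * dotv e (x - x2) ^+ 2 + gam * dotv e' (x - x2) ^+ 2
        - (be + kap) * dotv (x - x2) (x - x2)) <= u x) ->
    omega Psi a x2 * (lam * (al * dotv e e) - Lam * (d%:R * be) - G * C) <= f x2.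
  move=> g0 k0 hC cE /nbhs_eball[r r0 hr].
  have bk0 : 0 <= be + kap by rewrite addr_ge0.
  have := visc x2 (quadf c b' (al *: outer e + gam *: outer e' - (be + kap)%:M) x2) Ox.
  rewrite hess_quadf ?sym_outer_comb// => vv.
  apply: le_trans (vv _); last first.
    exists r; split => //; split; first by apply: C2on_quadf; exact: sym_outer_comb.
    by split => [|x xr x1]; rewrite ?quadf_center// quadf_outer; exact: hr.
  rewrite ler_wpM2l ?powR_ge0//.
  apply: le_trans (PucciMinus_outer_comb e e' (ltW lam0) lamLam bk0 al0 g0).
  lra.
(* Where B < 0, G times its touching paraboloid moves to the test function. Where B >= 0,
   [perturbed] equals u at the point and is at most u elsewhere, so the given quadratic already
   touches u from below. *)
have [B0|B0] := ltP (B y2 x2) 0.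
  have [b' [e' [gam [kap [g0 k0 hC nearB]]]]] := barrier_above hB (KB1' Ky) B0.
  apply: (touch (u x2) (b + G *: b') (G * gam) (G * kap) e') => //; rewrite ?mulr_ge0//.
    have := ler_wpM2l G0 hC; lra.
  have mB : Num.min 0 (B y2 x2) = B y2 x2 by apply/min_idPr; exact: ltW.
  near=> x => x1.
  have h1 : perturbed y2 x2 + dotv b (x - x2)
     + 2^-1 * (al * dotv e (x - x2) ^+ 2 - be * dotv (x - x2) (x - x2)) <= perturbed y2 x.
    by move: x1; near: x.
  have h2 : B y2 x <= B y2 x2 - (dotv b' (x - x2)
        + 2^-1 * (gam * dotv e' (x - x2) ^+ 2 - kap * dotv (x - x2) (x - x2))) by near: x.
  have h3 : G * Num.min 0 (B y2 x) <= G * B y2 x by rewrite ler_wpM2l// ge_min lexx orbT.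
  have E : dotv (b + G *: b') (x - x2) = dotv b (x - x2) + G * dotv b' (x - x2).
    by rewrite dotvDl dotvZl.
  have := ler_wpM2l G0 h2; move: h1; rewrite /perturbed mB E; lra.
have mB : Num.min 0 (B y2 x2) = 0 by apply/min_idPl.
have C_ge : - (G * C) <= 0.
  by rewrite oppr_le0 mulr_ge0.
apply: (touch (u x2) b 0 0 0) => //; rewrite ?mul0r ?mulr0 ?subr0//.
near=> x => x1.
have h1 : perturbed y2 x2 + dotv b (x - x2)
     + 2^-1 * (al * dotv e (x - x2) ^+ 2 - be * dotv (x - x2) (x - x2)) <= perturbed y2 x.
  by move: x1; near: x.
have := perturbed_le y2 x; move: h1; rewrite /perturbed mB mulr0 !addr0 mul0r; lra.
Unshelve. all: by end_near. Qed.

(** The contact conditions put two affine functions of slopes p0 and p1 below the minimum over y of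
    [perturbed]. If the slopes differ much over a distance s, a strongly convex quadratic fits
    between, and [contact_bulk] bounds its curvature by k + G C. *)
Lemma contact_pair Omega (f : 'rV[R]_d -> R) p0 p1 x0 x1 y0 y1 (s r0 k : R) :
  0 <= rho -> visc_super_bulk lam Lam Psi a Omega f u ->
  contact p0 x0 y0 -> contact p1 x1 y1 -> enorm (x1 - x0) <= s ->
  0 < s -> 0 < r0 -> 32 * Lam * d%:R * s ^+ 2 <= lam * r0 ^+ 2 ->
  ecball x0 r0 `<=` Omega -> Omega `<=` @B1 R n ->
  (forall x, ecball x0 r0 x -> 0 < omega Psi a x /\ f x <= omega Psi a x * k) ->
  0 <= k + G * C ->
  enorm (p1 - p0) <= 32 / lam * (k + G * C) * s.
Proof.
move=> rho0 visc [cx0 Ky0 min0] [cx1 Ky1 min1] hx10 s0 r00 hs hO OB hk kC.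
have [->|q0] := eqVneq p1 p0.
  by rewrite subrr enorm0 !mulr_ge0// ?invr_ge0 ltW.
set q := p1 - p0; have qn : 0 < enorm q by apply: enorm_gt0; rewrite subr_eq0.
pose e := (enorm q)^-1 *: q.
have ee : dotv e e = 1.
  rewrite /e dotvZl dotvZr -sqr_enorm; field; exact: lt0r_neq0.
have qe : q = enorm q *: e by rewrite /e scalerA divff ?scale1r// gt_eqF.
have en1 : enorm e = 1 by rewrite /enorm ee sqrtr1.
pose m := enorm q * s; have m0 : 0 < m by rewrite mulr_gt0.
pose Pq (v : 'rV[R]_d) : R := m / 8 * (dotv e v / (2 * s) + 1) ^+ 2 - m / (2 * r0 ^+ 2) * dotv v v.
(* The quadratic [Pq] is large enough at x0 and small enough on the boundary of the slab [Z] for the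
   minimum of [perturbed - p0 - Pq] over [Z] to be interior: on the sphere and on the lower face since p0 is
   a contact slope, on the upper face since p1 is one. There D^2 Pq is of order |p1 - p0| / s along [e]. *)
pose Z := ecball x0 r0 `&` [set x | `|dotv e (x - x0)| <= 2 * s].
have cdv (b : 'rV[R]_d) : continuous (fun x : 'rV[R]_d => dotv b (x - x0)).
  move=> x; have : {for x, continuous (fun x : 'rV[R]_d => dotv b (x - x0))}; last exact.
  apply: dotv_continuous; first exact: cst_continuous.
  by apply: continuousB => //; exact: cst_continuous.
have cdn : continuous (fun x : 'rV[R]_d => `|dotv e (x - x0)|).
  by move=> x; exact: (cvg_norm (cdv e x)).
have cZ : compact Z.
  apply: compact_closedI; first exact: ecball_compact.
  rewrite (_ : mkset _ = (fun x => `|dotv e (x - x0)|) @^-1` [set t | t <= 2 * s])//.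
  apply: preimage_closed; last exact: closed_le.
  by move=> x _; exact: cdn.
have Zx0 : Z x0.
  by split; rewrite /ecball/= subrr ?enorm0 ?dotv0r ?normr0 ?mulr_ge0// ltW.
have cP : continuous (fun x : 'rV[R]_d => dotv p0 (x - x0) + Pq (x - x0)).
  move=> x; have c1 := cdv e x.
  have c2 : {for x, continuous (fun x : 'rV[R]_d => dotv (x - x0) (x - x0))}.
    by apply: dotv_continuous; apply: continuousB => //; exact: cst_continuous.
  have c3 : {for x, continuous (fun x : 'rV[R]_d => dotv e (x - x0) / (2 * s) + 1)}.
    exact: (cvgD (cvgM c1 (cvg_cst _)) (cvg_cst _)).
  exact: (cvgD (cdv p0 x) (cvgB (cvgM (cvg_cst _) (cvgM c3 c3)) (cvgM (cvg_cst _) c2))).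
have [x2 [y2 [[hx2 hxi] Ky2 min2]]] := perturbed_min rho0 cZ (ex_intro _ _ Zx0) cP.
have cx2 : cB1 x2 by have := OB _ (hO _ hx2); rewrite /B1 /eball /cB1 /ecball/= => /ltW.
have Pq0 : Pq 0 = m / 8.
  by rewrite /Pq !dotv0r mul0r add0r expr1n mulr1 mulr0 subr0.
have /= := min2 x0 y0 Zx0 Ky0; rewrite subrr dotv0r Pq0 add0r /Pq.
set v2 := x2 - x0; set xi := dotv e v2 => le2.
have lower0 : perturbed y0 x0 + dotv p0 v2 <= perturbed y2 x2.
  by have := min0 x2 y2 cx2 Ky2; rewrite /v2 dotvBr; lra.
have lower1 : perturbed y0 x0 + dotv p0 v2 + dotv q (x2 - x1) <= perturbed y2 x2.
  have := min1 x2 y2 cx2 Ky2; have := min0 x1 y1 cx1 Ky1.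
  by rewrite /v2 /q !dotvBr !dotvBl; lra.
have i2s : 0 < 2 * s by lra.
have xib : -1 <= xi / (2 * s) <= 1.
  move: hxi; rewrite /= -/v2 -/xi ler_norml => /andP[h1 h2].
  by rewrite ler_pdivlMr// mulN1r h1 ler_pdivrMr// mul1r.
have v2r : enorm v2 <= r0 by [].
have vv : dotv v2 v2 = enorm v2 ^+ 2 by rewrite sqr_enorm.
have r2 : 0 < 2 * r0 ^+ 2 by rewrite mulr_gt0// exprn_gt0.
have Ppos : m / 8 <= m / 8 * (xi / (2 * s) + 1) ^+ 2 - m / (2 * r0 ^+ 2) * dotv v2 v2 by lra.
have sq4 : (xi / (2 * s) + 1) ^+ 2 <= 4 by move: xib => /andP[]; nra.
(* On the sphere [Pq] is at most m / 2 - m / 2 = 0, less than its value m / 8 at the center. *)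
have v2lt : enorm v2 < r0.
  rewrite lt_neqAle v2r andbT; apply/eqP => h; move: Ppos; rewrite vv h.
  have -> : m / (2 * r0 ^+ 2) * r0 ^+ 2 = m / 2 by field; rewrite gt_eqF.
  by have := ler_wpM2l (ltW m0) sq4; lra.
have vv0 : 0 <= m / (2 * r0 ^+ 2) * dotv v2 v2.
  by rewrite mulr_ge0 ?dotv_ge0// divr_ge0// ltW.
(* On the lower face the square in [Pq] vanishes. On the upper face [Pq] is at most m / 2, while the
   slope p1 raises [perturbed] by q.(x2 - x1) >= |q| (2 s - s) = m. *)
have xilt : `|xi| < 2 * s.
  rewrite ltr_norml; apply/andP; split.
    rewrite lt_neqAle; move: hxi; rewrite /= -/v2 -/xi ler_norml => /andP[-> _]; rewrite andbT.
    apply/eqP => h; move: Ppos; rewrite -h.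
    have -> : - (2 * s) / (2 * s) + 1 = 0 by field; rewrite gt_eqF.
    by rewrite expr0n mulr0; lra.
  rewrite lt_neqAle; move: hxi; rewrite /= -/v2 -/xi ler_norml => /andP[_ ->]; rewrite andbT.
  apply/eqP => h.
  have : m <= dotv q (x2 - x1).
    rewrite qe dotvZl /m ler_pM2l//.
    have -> : x2 - x1 = v2 - (x1 - x0) by rewrite /v2 opprB addrA subrK.
    rewrite dotvBr -/xi h.
    by have := dotv_le e (x1 - x0); rewrite en1 mul1r; lra.
  by have := ler_wpM2l (ltW m0) sq4; lra.
have Zx2 : nbhs x2 Z.
  have n1 : \forall x \near x2, enorm (x - x0) < r0.
    have c : {for x2, continuous (fun x : 'rV[R]_d => enorm (x - x0))}.
      by apply: enorm_continuous; apply: continuousB => //; exact: cst_continuous.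
    exact: (c _ (lt_nbhsl v2lt)).
  have n2 : \forall x \near x2, `|dotv e (x - x0)| < 2 * s.
    have c : {for x2, continuous (fun x : 'rV[R]_d => `|dotv e (x - x0)|)}.
      exact: cdn.
    exact: (c _ (lt_nbhsl xilt)).
  near=> x; split; apply: ltW; first by near: x.
  by near: x.
have [om_gt0 fk] := hk _ hx2.
have al0 : 0 <= m / (16 * s ^+ 2) by rewrite divr_ge0 ?mulr_ge0 ?sqr_ge0// ltW.
have be0 : 0 <= m / r0 ^+ 2 by rewrite divr_ge0 ?sqr_ge0// ltW.
pose b : 'rV[R]_d := p0 + (m / (8 * s) * (xi / (2 * s) + 1)) *: e - (m / r0 ^+ 2) *: v2.
have hmin : \forall x \near x2, cB1 x -> perturbed y2 x2 + dotv b (x - x2)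
     + 2^-1 * (m / (16 * s ^+ 2) * dotv e (x - x2) ^+ 2 - m / r0 ^+ 2 * dotv (x - x2) (x - x2))
     <= perturbed y2 x.
  near=> x => x1B.
  have Zx : Z x by near: x.
  have := min2 x y2 Zx Ky2.
  have hv : x - x0 = (x - x2) + v2 by rewrite /v2 addrA subrK.
  rewrite /Pq hv; move: (x - x2) => h; rewrite -/v2 -/xi.
  have lin (a1 a2 a3 z : 'rV[R]_d) c1 c2 :
      dotv (a1 + c1 *: a2 - c2 *: a3) z = dotv a1 z + c1 * dotv a2 z - c2 * dotv a3 z.
    by rewrite dotvBl dotvDl !dotvZl.
  have sq (z1 z2 : 'rV[R]_d) : dotv (z1 + z2) (z1 + z2) = dotv z1 z1 + 2 * dotv z1 z2 + dotv z2 z2.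
    by rewrite dotvDl !dotvDr (dotvC z2 z1); ring.
  rewrite /b lin sq (dotvDr h v2 p0) (dotvDr h v2 e) (dotvC v2 h) -/xi.
  move: (dotv e h) (dotv h v2) (dotv h h) (dotv p0 h) (dotv p0 v2) (dotv v2 v2) => eh hv2 hh ph pv v22.
  have -> : m / 8 * ((eh + xi) / (2 * s) + 1) ^+ 2 = m / 8 * (xi / (2 * s) + 1) ^+ 2
     + m / (8 * s) * (xi / (2 * s) + 1) * eh + 2^-1 * (m / (16 * s ^+ 2) * eh ^+ 2).
    by field; rewrite gt_eqF.
  have -> : m / (2 * r0 ^+ 2) = 2^-1 * (m / r0 ^+ 2) by field; rewrite gt_eqF.
  by lra.
have hb := contact_bulk visc (hO _ hx2) Ky2 al0 be0 hmin.
rewrite ee mulr1 in hb.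
have : lam * (m / (16 * s ^+ 2)) - Lam * (d%:R * (m / r0 ^+ 2)) - G * C <= k.
  by rewrite -(ler_pM2l om_gt0) (le_trans hb).
(* The smallness of s against r0 makes the concave part of [Pq] cost at most half of the gain along
   e. *)
have hs' : Lam * (d%:R * (m / r0 ^+ 2)) <= lam * (m / (32 * s ^+ 2)).
  have E1 : Lam * (d%:R * (m / r0 ^+ 2)) = 32 * Lam * d%:R * s ^+ 2 * (m / (32 * s ^+ 2 * r0 ^+ 2)).
    by field; rewrite !gt_eqF.
  have E2 : lam * (m / (32 * s ^+ 2)) = lam * r0 ^+ 2 * (m / (32 * s ^+ 2 * r0 ^+ 2)).
    by field; rewrite !gt_eqF.
  rewrite E1 E2 ler_wpM2r// divr_ge0 ?(ltW m0)//.
  by apply: mulr_ge0; [apply: mulr_ge0|]; rewrite ?sqr_ge0.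
have E3 : lam * (m / (16 * s ^+ 2)) = 2 * (lam * (m / (32 * s ^+ 2))) by field; rewrite gt_eqF.
rewrite E3 => h.
have {}h : lam * (m / (32 * s ^+ 2)) <= k + G * C by lra.
have -> : enorm q = 32 / lam * (lam * (m / (32 * s ^+ 2))) * s.
  by rewrite /m; field; rewrite !gt_eqF.
rewrite ler_pM2r// ler_wpM2l// divr_ge0// ltW.
Unshelve. all: by end_near. Qed.

End Contact.

(** * The transmission condition tested with kinked functions *)

Section Interface.
Context {R : realType} {n : nat}.
Local Notation d := n.+2.
Variables (alpha K : R) (Psi : 'rV[R]_n.+1 -> R).
Hypothesis alpha0 : 0 < alpha.
Hypothesis K0 : 0 <= K.
Hypothesis dPsi : forall y, B1' y -> differentiable Psi y.
Hypothesis hPsi : forall y z, B1' y -> B1' z ->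
    enorm (grad Psi y - grad Psi z) <= K * powR (enorm (y - z)) alpha.
Implicit Types (x : 'rV[R]_d).

Lemma B1_xprime x : B1 x -> B1' (xprime x).
Proof.
rewrite /B1 /B1' /eball/= !subr0 => h.
exact: le_lt_trans (enorm_xprime _) h.
Qed.

Lemma height_continuous x : B1' (xprime x) -> {for x, continuous (height Psi)}.
Proof.
move=> hx; have c1 : {for x, continuous (fun x : 'rV[R]_d => Psi (xprime x))}.
  apply: (@continuous_comp _ _ _ (@xprime R n) Psi); first exact: xprime_continuous.
  by apply: differentiable_continuous; exact: dPsi.
have c0 : {for x, continuous (@xlast R n)} by exact: xlast_continuous.
exact: (cvgB c0 c1).
Qed.

Lemma derive_height x v : B1' (xprime x) ->
  derivable (height Psi) x v /\ 'D_v (height Psi) x = dotv (nvec Psi (xprime x)) v.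
Proof.
move=> hx; have dx := dPsi hx.
have E (h : R) : h != 0 -> h^-1 *: (height Psi (h *: v + x) - height Psi x) =
    xlast v - h^-1 *: (Psi (h *: xprime v + xprime x) - Psi (xprime x)).
  by move=> h0; rewrite /height xlastD xlastZ xprimeD xprimeZ /GRing.scale/=; field.
have cv : (fun h : R => xlast v - h^-1 *: (Psi (h *: xprime v + xprime x) - Psi (xprime x))) @ 0^'
    --> xlast v - 'D_(xprime v) Psi (xprime x).
  apply: cvgB; first exact: cvg_cst.
  exact: (@diff_derivable _ _ _ _ _ (xprime v) dx).
have cv2 : (fun h : R => h^-1 *: (height Psi (h *: v + x) - height Psi x)) @ 0^'
    --> dotv (nvec Psi (xprime x)) v.
  have -> : dotv (nvec Psi (xprime x)) v = xlast v - 'D_(xprime v) Psi (xprime x).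
    by rewrite derive_grad// dotv_split xprime_mkpt xlast_mkpt mul1r dotvNl addrC.
  apply: cvg_trans cv; apply: near_eq_cvg; near=> h.
  by rewrite E//; near: h; exact: nbhs_dnbhs_neq.
by split; [apply/cvg_ex; exists (dotv (nvec Psi (xprime x)) v)|exact: cvg_lim].
Unshelve. all: by end_near. Qed.

Lemma partial_affine_height (c t : R) (b x1 x : 'rV[R]_d) i : B1' (xprime x) ->
  derivable (fun x => quadf c b 0 x1 x + t * height Psi x) x (evec R i) /\
  partial i (fun x => quadf c b 0 x1 x + t * height Psi x) x =
    (b + t *: nvec Psi (xprime x)) ord0 i.
Proof.
move=> hx; have [d1 p1] := partial_quadf c b x1 x i (trmx0 R d d).
have [d2 p2] := derive_height (evec R i) hx.
have d3 : derivable (fun x => t *: height Psi x) x (evec R i) by exact: derivableZ.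
have -> : (fun x => quadf c b 0 x1 x + t * height Psi x) =
    quadf c b 0 x1 + (fun x => t *: height Psi x) by [].
split; first exact: derivableD.
rewrite /partial deriveD// deriveZ// p2 -/(partial i _ x) p1 mulmx0 !mxE addr0.
by rewrite dotv_evec !mxE.
Qed.

Lemma C1on_affine_height (c t : R) (b x1 : 'rV[R]_d) U : U `<=` @B1 R n -> open U ->
  C1on U (fun x => quadf c b 0 x1 x + t * height Psi x).
Proof.
move=> UB oU; split=> [x /UB/B1_xprime hx|i].
  exact: (cvgD (@quadf_continuous _ _ _ _ _ _ x) (cvgM (cvg_cst t) (height_continuous hx))).
split=> x Ux; first by have [] := partial_affine_height c t b x1 i (B1_xprime (UB _ Ux)).
have hx := B1_xprime (UB _ Ux).
have cg : {for x, continuous (fun x : 'rV[R]_d => b ord0 i + t * nvec Psi (xprime x) ord0 i)}.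
  have c1 : {for x, continuous (fun x : 'rV[R]_d => nvec Psi (xprime x))}.
    apply: enorm_continuous_at => e e0.
    have c3 : {for x, continuous (fun z : 'rV[R]_d => grad Psi (xprime z))}.
      apply: (@continuous_comp _ _ _ (@xprime R n) (grad Psi)); first exact: xprime_continuous.
      exact: (grad_Psi_continuous K0 hPsi).
    near=> z.
    have -> : nvec Psi (xprime x) - nvec Psi (xprime z) = mkpt (- (grad Psi (xprime x) - grad Psi (xprime z))) 0.
      by apply/rowP => j; rewrite !mxE; case: ifP => _; rewrite ?subrr// opprD.
    rewrite /enorm dotv_split xprime_mkpt xlast_mkpt mulr0 addr0 -/(enorm _) enormN enormBC.
    near: z; exact: (c3 _ (eball_nbhs _ e0)).
  exact: (cvgD (cvg_cst _) (cvgM (cvg_cst t) (coord_comp_continuous c1))).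
have pE z : U z -> partial i (fun x => quadf c b 0 x1 x + t * height Psi x) z =
    b ord0 i + t * nvec Psi (xprime z) ord0 i.
  move=> Uz; have [_ ->] := partial_affine_height c t b x1 i (B1_xprime (UB _ Uz)).
  by rewrite !mxE.
rewrite /prop_for /continuous_at pE//.
have E : {near nbhs x, (fun z : 'rV[R]_d => b ord0 i + t * nvec Psi (xprime z) ord0 i) =1
    partial i (fun x => quadf c b 0 x1 x + t * height Psi x)}.
  by have := open_nbhs_nbhs (conj oU Ux); apply: filterS => z Uz; rewrite pE.
exact: (cvg_trans (near_eq_cvg E) cg).
Unshelve. all: by end_near. Qed.

Lemma eball_open k (v : 'rV[R]_k) r : open (eball v r).
Proof.
rewrite (_ : eball v r = (fun w => enorm (w - v)) @^-1` [set x | x < r])//.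
have c w : {for w, continuous (fun w : 'rV[R]_k => enorm (w - v))}.
  by apply: enorm_continuous; apply: continuousB => //; exact: cst_continuous.
by apply: open_comp; [move=> w _; exact: c|exact: open_lt].
Qed.

(** Test with an affine function plus t times the positive part of the height. Its normal derivative
    jumps by t sqrt(1 + |grad Psi|^2), which is at least t. *)
Lemma visc_interface_kink (g u : 'rV[R]_d -> R) x0 (p : 'rV[R]_d) t :
  visc_super_interface Psi g u -> Gamma Psi x0 -> 0 <= t ->
  (\forall x \near x0, cB1 x ->
     u x0 + dotv p (x - x0) + t * Num.max (height Psi x) 0 <= u x) ->
  t <= g x0.
Proof.
move=> visc Gx0 t0 /nbhs_eball[r1 r10 hr1].
have Bx0 : B1 x0 by case: Gx0.
have ht0 : height Psi x0 = 0 by rewrite /height; case: Gx0 => _ ->; rewrite subrr.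
have [r2 r20 hr2] : exists2 r, 0 < r & eball x0 r `<=` @B1 R n.
  by apply: nbhs_eball; apply: open_nbhs_nbhs; split => //; exact: eball_open.
pose r := Num.min r1 r2.
have r0 : 0 < r by rewrite lt_min r10.
have rB1 : eball x0 r `<=` @B1 R n.
  by move=> x xr; apply: hr2; rewrite /eball/= (lt_le_trans xr)// ge_min lexx orbT.
have rn : eball x0 r `<=` eball x0 r1.
  by move=> x xr; rewrite /eball/= (lt_le_trans xr)// ge_min lexx.
pose phiP := fun x => quadf (u x0) p 0 x0 x + t * height Psi x.
(* The vanishing multiple of the height lets one regularity lemma and one gradient formula serve
   both sides. *)
pose phiM := fun x => quadf (u x0) p 0 x0 x + 0 * height Psi x.
pose phi x := quadf (u x0) p 0 x0 x + t * Num.max (height Psi x) 0.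
have op : open (eball x0 r) by exact: eball_open.
have CP : C1on (eball x0 r) phiP by exact: C1on_affine_height.
have CM : C1on (eball x0 r) phiM by exact: C1on_affine_height.
have quadE x : quadf (u x0) p 0 x0 x = u x0 + dotv p (x - x0).
  by rewrite /quadf mulmx0 dotv0l mulr0 addr0.
have gradE s : grad (fun x => quadf (u x0) p 0 x0 x + s * height Psi x) x0 = p + s *: nvec Psi (xprime x0).
  apply/rowP => i; rewrite mxE.
  by have [_ ->] := partial_affine_height (u x0) s p x0 i (B1_xprime Bx0).
have := visc x0 r phi phiP phiM Gx0 r0 CP CM; rewrite !gradE scale0r addr0.
have clP x : eball x0 r x -> closure (OmegaP Psi) x -> 0 <= height Psi x.
  move=> xr cx; rewrite leNgt; apply/negP => hneg.
  have nb : nbhs x [set z | height Psi z < 0].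
    have hc := height_continuous (B1_xprime (rB1 _ xr)).
    exact: (hc _ (lt_nbhsl hneg)).
  have [z [[_ /= h1] /= h2]] := cx _ nb.
  by have := lt_trans h1 h2; rewrite ltxx.
have clM x : eball x0 r x -> closure (OmegaM Psi) x -> height Psi x <= 0.
  move=> xr cx; rewrite leNgt; apply/negP => hpos.
  have nb : nbhs x [set z | 0 < height Psi z].
    have hc := height_continuous (B1_xprime (rB1 _ xr)).
    exact: (hc _ (lt_nbhsr hpos)).
  have [z [[_ /= h1] /= h2]] := cx _ nb.
  by move: h1; rewrite oppr_gt0 => h1; have := lt_trans h1 h2; rewrite ltxx.
have e1 : forall x, eball x0 r x -> closure (OmegaP Psi) x -> phi x = phiP x.
  by move=> x xr cx; rewrite /phi /phiP; congr (_ + t * _); apply/max_idPl; exact: clP.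
have e2 : forall x, eball x0 r x -> closure (OmegaM Psi) x -> phi x = phiM x.
  move=> x xr cx; rewrite /phi /phiM mul0r; congr (_ + _).
  by rewrite (_ : Num.max _ _ = 0) ?mulr0//; apply/max_idPr; exact: clM.
have e3 : phi x0 = u x0.
  by rewrite /phi quadE subrr dotv0r ht0 maxxx mulr0 !addr0.
have e4 : forall x, eball x0 r x -> cB1 x -> phi x <= u x.
  by move=> x xr x1; rewrite /phi quadE; apply: hr1 => //; exact: rn.
move=> /(_ e1 e2 e3 e4); apply: le_trans.
rewrite dotvDl addrAC subrr add0r dotvZl.
have -> : nu Psi x0 = (Num.sqrt (1 + enorm (grad Psi (xprime x0)) ^+ 2))^-1 *: nvec Psi (xprime x0).
  by rewrite /nu; congr (_ *: _); apply/rowP => i; rewrite !mxE.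
rewrite dotvZr nvec_sq (addrC 1); set q := _ + 1.
have q1 : 1 <= q by rewrite lerDr sqr_ge0.
have q0 : 0 < q by apply: lt_le_trans q1.
have -> : (Num.sqrt q)^-1 * q = Num.sqrt q.
  by rewrite -{2}[q](sqr_sqrtr (ltW q0)) expr2 mulKf// gt_eqF// sqrtr_gt0.
have : Num.sqrt 1 <= Num.sqrt q by rewrite ler_sqrt// ltW.
by rewrite sqrtr1 => q2; rewrite ler_peMr.
Qed.

End Interface.

(** * Lower Riemann sums and counting *)

Section RiemannLower.
Context {R : realType}.
Local Notation mu := (@lebesgue_measure R).

(** The integral of a nonnegative function is a supremum over simple functions below it, hence
    monotone without measurability. This matters because the inner iterated integrals are not shown
    to be measurable. *)
Lemma ge0_le_integralT (f g : R -> \bar R) : (forall x, (0 <= f x)%E) ->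
  (forall x, (f x <= g x)%E) -> (\int[mu]_x f x <= \int[mu]_x g x)%E.
Proof.
move=> f0 fg; rewrite !ge0_integralTE//; last by move=> x; exact: le_trans (fg x).
apply: ereal_sup_le => _ [h /= hf <-]; exists h => //= x.
exact: le_trans (hf x) (fg x).
Qed.

Definition cell (x0 e : R) (j : nat) (t : R) : bool := (x0 + e * j%:R <= t < x0 + e * j.+1%:R).

Lemma cell_inj x0 e i j t : 0 < e -> cell x0 e i t -> cell x0 e j t -> i = j.
Proof.
move=> e0 /andP[i1 i2] /andP[j1 j2].
have := le_lt_trans i1 j2; have := le_lt_trans j1 i2.
rewrite !ltrD2l !ltr_pM2l// !ltr_nat !ltnS => h1 h2.
by apply/eqP; rewrite eqn_leq h1 h2.
Qed.

Lemma integral_cells_lower (f : R -> \bar R) (N : nat) (x0 e : R) (v : 'I_N -> R) :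
  0 < e -> (forall j, 0 <= v j) -> (forall t, (0 <= f t)%E) ->
  (forall (j : 'I_N) t, cell x0 e j t -> ((v j)%:E <= f t)%E) ->
  ((\sum_(j < N) e * v j)%:E <= \int[mu]_t f t)%E.
Proof.
move=> e0 v0 f0 hf.
pose I (j : 'I_N) : set R := [set` `[x0 + e * (j : nat)%:R, x0 + e * (j : nat).+1%:R[ ].
have IE j t : I j t = cell x0 e j t by rewrite /I/= in_itv.
have mI j : measurable (I j) by exact: measurable_itv.
have muI j : mu (I j) = e%:E.
  rewrite /I lebesgue_measure_itv/= lte_fin ltrD2l ltr_pM2l// ltr_nat ltnSn -EFinB.
  by congr EFin; rewrite -natr1; ring.
apply: (@le_trans _ _ (\int[mu]_t \sum_(j < N) (v j * \1_(I j) t)%:E)%E).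
  rewrite ge0_integral_sum//; last 2 first.
  - move=> j; apply/measurable_EFinP; apply: measurable_funM => //.
    by apply: measurable_indic; exact: mI.
  - by move=> j t _; rewrite lee_fin mulr_ge0.
  rewrite -sumEFin le_eqVlt; apply/orP; left; apply/eqP; apply: eq_bigr => j _.
  under eq_integral do rewrite EFinM.
  rewrite ge0_integralZl_EFin//; last first.
    by apply/measurable_EFinP; apply: measurable_indic; exact: mI.
  have hj : (\int[mu]_x (\1_(I j) x)%:E)%E = e%:E.
    rewrite -(muI j) -[I j in RHS]setIT.
    by apply: integral_indic; [exact: measurableT|exact: mI].
  by rewrite hj -EFinM mulrC.
apply: ge0_le_integralT => t.
  by apply: sume_ge0 => j _; rewrite lee_fin mulr_ge0.
have [[j jt]|nj] := pselect (exists j, I j t).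
  rewrite (bigD1 j)//= big1 ?adde0; last first.
    move=> i ij; rewrite indicE memNset ?mulr0// => it.
    move: ij => /eqP; apply; apply: val_inj => /=.
    by move: it jt; rewrite !IE; exact: (cell_inj e0).
  by rewrite indicE mem_set// mulr1; apply: hf; rewrite -IE.
rewrite big1// => j _; rewrite indicE memNset ?mulr0// => jt; apply: nj; by exists j.
Qed.

Lemma big_tuple_cons (T : finType) k (F : k.+1.-tuple T -> R) :
  \sum_(j : k.+1.-tuple T) F j = \sum_(i : T) \sum_(j : k.-tuple T) F (cons_tuple i j).
Proof.
rewrite pair_big/= (reindex (fun p : T * k.-tuple T => cons_tuple p.1 p.2))//=.
exists (fun j => (thead j, [tuple of behead j])) => [[i j] _|j _] /=.
  by congr (_, _); apply: val_inj.
by apply: val_inj; rewrite /= -[RHS]/(tval j); case/tupleP: j => i j; rewrite theadE.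
Qed.

Definition in_cell (x0 e : R) N k (j : k.-tuple 'I_N) (s : seq R) : bool :=
  all2 (fun (i : 'I_N) t => cell x0 e i t) j s.

Lemma iter_int_ge0 k (F : seq R -> \bar R) : (forall s, (0 <= F s)%E) -> (0 <= iter_int k F)%E.
Proof.
elim: k F => [|k IH] F F0 //=; apply: integral_ge0 => t _.
by apply: IH => s.
Qed.

(** By induction on the dimension: over each cell of the first variable the inner integral is
    bounded below by a constant, namely the sum over the remaining indices. *)
Lemma iter_int_cells_lower k N (F : seq R -> \bar R) (x0 e : R) (c : k.-tuple 'I_N -> R) :
  0 < e -> (forall j, 0 <= c j) -> (forall s, (0 <= F s)%E) ->
  (forall j s, in_cell x0 e j s -> ((c j)%:E <= F s)%E) ->
  ((\sum_(j : k.-tuple 'I_N) e ^+ k * c j)%:E <= iter_int k F)%E.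
Proof.
move=> e0; elim: k F c => [|k IH] F c c0 F0 hF /=.
  rewrite (bigD1 [tuple])//= big1 ?addr0; last by move=> j /eqP[]; exact: tuple0.
  by rewrite mul1r; apply: hF.
rewrite big_tuple_cons.
have -> : \sum_(i : 'I_N) \sum_(j : k.-tuple 'I_N) e ^+ k.+1 * c (cons_tuple i j) =
    \sum_(i < N) e * \sum_(j : k.-tuple 'I_N) e ^+ k * c (cons_tuple i j).
  by apply: eq_bigr => i _; rewrite mulr_sumr; apply: eq_bigr => j _; rewrite exprS mulrA.
apply: (@integral_cells_lower _ N x0) => //.
- by move=> i; apply: sumr_ge0 => j _; rewrite mulr_ge0// exprn_ge0// ltW.
- by move=> t; apply: iter_int_ge0.
- move=> i t it; apply: IH => // j s js; apply: hF.
  by rewrite /in_cell/= it.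
Qed.
End RiemannLower.

Section Counting.
Context {R : realType}.

Lemma card_ord_diameter N (S : pred 'I_N) (D : R) : 0 <= D ->
  (forall i j, S i -> S j -> (i : nat)%:R - (j : nat)%:R <= D) -> #|S|%:R <= D + 1.
Proof.
move=> D0 hS; have [i0 Si0|S0] := pickP S; last first.
  by rewrite (eq_card0 S0) addr_ge0.
pose m := [arg min_(i < i0 | S i) (i : nat)].
have [Sm mmin] : S m /\ forall j, S j -> (m <= j)%N.
  by rewrite /m; case: arg_minnP.
pose f (i : 'I_N) : 'I_(Num.truncn D).+1 := inord (i - m).
have fb i : S i -> (i - m < (Num.truncn D).+1)%N.
  move=> Si; rewrite -(ltr_nat R) natrB ?mmin//.
  by apply: le_lt_trans (hS _ _ Si Sm) _; have /andP[] := truncn_itv D0.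
have fi : {in S &, injective f}.
  move=> i j Si Sj /(congr1 val); rewrite /= !inordK ?fb// => h.
  apply: val_inj => /=; have := mmin _ Si; have := mmin _ Sj => h1 h2.
  by rewrite -(subnK h2) h subnK.
have : (#|S| <= (Num.truncn D).+1)%N.
  by rewrite -(card_in_image fi) -[X in (_ <= X)%N]card_ord max_card.
rewrite -(ler_nat R) => /le_trans; apply; rewrite -natr1 lerD2r.
by have /andP[] := truncn_itv D0.
Qed.

(** Volumes are compared by counting points of a grid in the cube of side A whose mesh eta is below
    every radius. An interval of length 2 r contains at most 2 r / eta + 1 <= 3 r / eta coordinates,
    whence the factor 3. *)
Lemma covering_volume k (J : finType) (P : pred J) (p : J -> 'rV[R]_k) (r : J -> R) (A : R) :
  0 < A -> (forall j, P j -> 0 < r j) ->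
  (forall x : 'rV[R]_k, (forall i, 0 <= x ord0 i <= A) ->
    exists2 j, P j & forall i, `|x ord0 i - p j ord0 i| <= r j) ->
  A ^+ k <= \sum_(j | P j) (3 * r j) ^+ k.
Proof.
move=> A0 r0 cov.
have [N N0 hN] : exists2 N : nat, (0 < N)%N & forall j, P j -> A / N%:R <= r j.
  pose N := (\max_(j | P j) (Num.truncn (A / r j)).+1).+1.
  exists N => // j Pj; rewrite ler_pdivrMr ?ltr0n// mulrC -ler_pdivrMr ?r0//.
  have h : ((Num.truncn (A / r j)).+1 <= N)%N.
    by apply: leqW; exact: (@leq_bigmax_cond _ P (fun j => (Num.truncn (A / r j)).+1) j Pj).
  apply: ltW; apply: lt_le_trans (_ : (Num.truncn (A / r j)).+1%:R <= _); last by rewrite ler_nat.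
  by have /andP[] := truncn_itv (divr_ge0 (ltW A0) (ltW (r0 _ Pj))).
pose eta := A / N%:R; have N0' : 0 < N%:R :> R by rewrite ltr0n.
have eta0 : 0 < eta by rewrite divr_gt0.
pose S j (i : 'I_k) : pred 'I_N := fun m => `|eta * (m : nat)%:R - p j ord0 i| <= r j.
have cS j i : P j -> #|S j i|%:R <= 3 * r j / eta.
  move=> Pj; have rj := r0 _ Pj.
  have D0 : 0 <= 2 * r j / eta by rewrite divr_ge0 ?mulr_ge0// ltW.
  have h : #|S j i|%:R <= 2 * r j / eta + 1.
    apply: card_ord_diameter => // m1 m2; rewrite /S !ler_norml => /andP[_ h1] /andP[h2 _].
    by rewrite ler_pdivlMr// mulrBl ![_ * eta]mulrC; lra.
  apply: le_trans h _.
  have : 1 <= r j / eta by rewrite ler_pdivlMr// mul1r hN.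
  have -> : 3 * r j / eta = 2 * r j / eta + r j / eta by field; rewrite gt_eqF.
  by rewrite lerD2l.
pose ind j (i : 'I_k) (m : 'I_N) : R := (S j i m)%:R.
have ind0 j i m : 0 <= ind j i m by [].
have count : (N ^ k)%:R <= \sum_(f : {ffun 'I_k -> 'I_N}) \sum_(j | P j) \prod_i ind j i (f i).
  have -> : (N ^ k = #|{ffun 'I_k -> 'I_N}|)%N by rewrite card_ffun !card_ord.
  rewrite -sum1_card natr_sum; apply: ler_sum => f _.
  have [|j Pj hj] := cov (\row_i (eta * (f i : nat)%:R)).
    move=> i; rewrite mxE mulr_ge0 ?(ltW eta0)//= /eta -mulrA ler_piMr ?(ltW A0)//.
    by rewrite mulrC ler_pdivrMr// mul1r ler_nat ltnW.
  rewrite (bigD1 j)//= big1 => [|i _]; last first.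
    by rewrite /ind /S; have := hj i; rewrite mxE => ->.
  by rewrite lerDl; apply: sumr_ge0 => i _; apply: prodr_ge0.
have : (N ^ k)%:R <= \sum_(j | P j) (3 * r j / eta) ^+ k.
  apply: le_trans count _; rewrite exchange_big/=; apply: ler_sum => j Pj.
  (* Summing over the grid a product of conditions on single coordinates gives the product of the
     one-dimensional counts. *)
  rewrite -bigA_distr_bigA -[X in _ ^+ X]card_ord -prodr_const.
  apply: ler_prod => i _; rewrite sumr_ge0//=.
  apply: le_trans (cS _ i Pj); rewrite /ind -natr_sum ler_nat -sum1_card [X in (_ <= X)%N]big_mkcond/=.
  by apply: leq_sum => m _; rewrite -[m \in S j i]/(S j i m); case: (S j i m).
under eq_bigr do rewrite expr_div_n.
rewrite -mulr_suml ler_pdivlMr ?exprn_gt0// natrX -exprMn.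
by rewrite /eta mulrCA divff ?mulr1// gt_eqF.
Qed.
End Counting.

(** * Extension of u, cells, and elementary power inequalities *)

Section Extension.
Context {R : realType} {k : nat}.

Lemma ball_retract_continuous :
  continuous (fun x : 'rV[R]_k => (Num.max 1 (enorm x))^-1 *: x).
Proof.
move=> x.
have c1 : {for x, continuous (fun x : 'rV[R]_k => enorm x)} by exact: enorm_continuous.
have c2 : {for x, continuous (fun x : 'rV[R]_k => Num.max 1 (enorm x))}.
  by apply: continuous_max => //; exact: cst_continuous.
have m0 : Num.max 1 (enorm x) != 0 by rewrite gt_eqF// lt_max ltr01.
exact: (cvgZ (cvgV m0 c2) cvg_id).
Qed.

(** Compose with the radial retraction x / max(1, |x|). The extension allows neighborhoods in the
    whole space, and the viscosity conditions see only values in the closed ball. *)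
Lemma continuous_ball_extension (u : 'rV[R]_k -> R) :
  {within ecball 0 1, continuous u} ->
  exists2 v, continuous v & forall x, ecball 0 1 x -> v x = u x.
Proof.
move=> /subspace_continuousP cu.
pose rt (x : 'rV[R]_k) := (Num.max 1 (enorm x))^-1 *: x.
have rtB x : ecball 0 1 (rt x).
  rewrite /ecball/= subr0 enormZ ger0_norm ?invr_ge0 ?le_max ?ler01//.
  rewrite mulrC ler_pdivrMr ?lt_max ?ltr01// mul1r le_max lexx orbT//.
exists (u \o rt); last first.
  move=> x; rewrite /ecball/= subr0 => x1; congr u; rewrite /rt.
  by rewrite (_ : Num.max _ _ = 1) ?invr1 ?scale1r//; apply/max_idPl.
move=> x; apply: cvg_trans (cu _ (rtB x)) => /= A.
rewrite /within /= => hA.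
have h2 : nbhs (rt x) [set y | ecball 0 1 y -> A (u y)] by exact: hA.
have h3 : nbhs x (rt @^-1` [set y | ecball 0 1 y -> A (u y)]).
  exact: (@ball_retract_continuous x _ h2).
suff : nbhs x ((u \o rt) @^-1` A) by [].
by apply: filterS h3 => z /=; apply; exact: rtB.
Qed.

End Extension.

Section Cells.
Context {R : realType}.

Lemma in_cellP (x0 e : R) N k (j : k.-tuple 'I_N) (s : seq R) (i : 'I_k) :
  in_cell x0 e j s -> cell x0 e (tnth j i) (nth 0 s i).
Proof.
rewrite /in_cell all2E size_tuple => /andP[/eqP sz /allP h].
have := h (tnth j i, nth 0 s i); apply.
have -> : (tnth j i, nth 0 s i) = nth (tnth j i, 0) (zip j s) i.
  by rewrite nth_zip -?tnth_nth//= size_tuple.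
by rewrite mem_nth// size_zip size_tuple -sz minnn.
Qed.

Lemma cell_exists (x0 e : R) N (t : R) : 0 < e -> x0 <= t < x0 + e * N%:R ->
  exists j : 'I_N, cell x0 e j t.
Proof.
move=> e0 /andP[t1 t2].
have q0 : 0 <= (t - x0) / e by rewrite divr_ge0 ?subr_ge0// ltW.
have /andP[h1 h2] := truncn_itv q0.
have hN : (Num.truncn ((t - x0) / e) < N)%N.
  rewrite -(ltr_nat R); apply: le_lt_trans h1 _.
  by rewrite ltr_pdivrMr// mulrC; lra.
exists (Ordinal hN); rewrite /cell/=; move: h1 h2.
rewrite ler_pdivlMr// ltr_pdivrMr// => h1 h2; apply/andP; split; rewrite mulrC; lra.
Qed.

Lemma cell_dist (x0 e : R) j t1 t2 : cell x0 e j t1 -> cell x0 e j t2 -> `|t1 - t2| <= e.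
Proof.
move=> /andP[a1 a2] /andP[b1 b2]; rewrite -natr1 mulrDr mulr1 in a2 b2.
rewrite ler_norml; apply/andP; split; lra.
Qed.

Lemma powD_le (c E : R) k : 0 <= c -> 0 <= E -> (c + E) ^+ k <= 2 ^+ k * (c ^+ k + E ^+ k).
Proof.
move=> c0 E0; rewrite -[X in X <= _]mul1r.
have [cE|Ec] := leP c E.
  apply: le_trans (_ : (2 * E) ^+ k <= _).
    by rewrite mul1r lerXn2r ?nnegrE ?addr_ge0 ?mulr_ge0//; lra.
  by rewrite exprMn ler_wpM2l ?exprn_ge0// lerDr exprn_ge0.
apply: le_trans (_ : (2 * c) ^+ k <= _).
  by rewrite mul1r lerXn2r ?nnegrE ?addr_ge0 ?mulr_ge0//; lra.
by rewrite exprMn ler_wpM2l ?exprn_ge0// lerDl exprn_ge0.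
Qed.

Lemma scaled_powD_le (c E e q : R) k : 0 <= c -> 0 <= E -> 0 <= e -> 0 <= q ->
  (q * e * (c + E)) ^+ k <= (2 * q) ^+ k * (e ^+ k * c ^+ k + e ^+ k * E ^+ k).
Proof.
move=> c0 E0 e0 q0; rewrite 3!exprMn -mulrDr.
have qe : 0 <= q ^+ k * e ^+ k by rewrite mulr_ge0 ?exprn_ge0.
have := ler_wpM2l qe (powD_le k c0 E0).
move: (c ^+ k) (E ^+ k) (e ^+ k) (q ^+ k) (2 ^+ k) ((c + E) ^+ k) => x y z t p w; lra.
Qed.

Lemma sum_pow_le (x y z : R) k : 0 <= x -> 0 <= y -> 0 <= z ->
  x ^+ k.+1 + y ^+ k.+1 + z ^+ k.+1 <= (x + y + z) ^+ k.+1.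
Proof.
have two (p q : R) : 0 <= p -> 0 <= q -> p ^+ k.+1 + q ^+ k.+1 <= (p + q) ^+ k.+1.
  move=> p0 q0; rewrite [X in _ <= X]exprS mulrDl !exprS lerD// ler_wpM2l//.
    by rewrite lerXn2r ?nnegrE ?addr_ge0// lerDl.
  by rewrite lerXn2r ?nnegrE ?addr_ge0// lerDr.
move=> x0 y0 z0; apply: le_trans (two _ _ (addr_ge0 x0 y0) z0).
by rewrite lerD2r two.
Qed.

(** A finite root excludes an infinite integral, whose root would be infinite. *)
Lemma poweR_root_fin (I : \bar R) (N : R) k : (0 <= I)%E ->
  poweR I (k.+1%:R^-1) = N%:E -> I = (N ^+ k.+1)%:E /\ 0 <= N.
Proof.
case: I => [r| |]//.
- rewrite lee_fin => r0; rewrite poweR_EFin => -[<-]; split; last exact: powR_ge0.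
  by congr EFin; rewrite -powR_mulrn ?powR_ge0// -powRrM mulVf ?pnatr_eq0// powRr1.
- by move=> _; rewrite poweRyr// invr_eq0 pnatr_eq0.
Qed.

End Cells.

(** * Continuity of f_+ / omega off the interface *)

Section Density.
Context {R : realType} {n : nat}.
Local Notation d := n.+2.
Variables (Psi : 'rV[R]_n.+1 -> R) (a : 'rV[R]_d -> R).
Hypothesis dPsi : forall y, B1' y -> differentiable Psi y.
Hypothesis ca : forall x, @B1 R n x -> {for x, continuous a}.
Implicit Types (x : 'rV[R]_d) (f : 'rV[R]_d -> R).

Lemma B1_nbhs x : B1 x -> nbhs x (@B1 R n).
Proof. by move=> hx; apply: open_nbhs_nbhs; split => //; exact: eball_open. Qed.

Lemma OmegaP_nbhs x : OmegaP Psi x -> nbhs x (OmegaP Psi).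
Proof.
move=> [hx h0]; have hc := height_continuous dPsi (B1_xprime hx).
have h1 : nbhs x [set z | 0 < height Psi z] by exact: (hc _ (lt_nbhsr h0)).
by apply: filterS2 (B1_nbhs hx) h1 => z z1 z2; split.
Qed.

Lemma OmegaM_nbhs x : OmegaM Psi x -> nbhs x (OmegaM Psi).
Proof.
move=> [hx]; rewrite oppr_gt0 => h0; have hc := height_continuous dPsi (B1_xprime hx).
have h1 : nbhs x [set z | height Psi z < 0] by exact: (hc _ (lt_nbhsl h0)).
by apply: filterS2 (B1_nbhs hx) h1 => z z1 z2; split => //; rewrite oppr_gt0.
Qed.

Lemma omega_gt0 x : height Psi x != 0 -> 0 < omega Psi a x.
Proof. by move=> h; rewrite powR_gt0// normr_gt0. Qed.

Lemma omega_continuous x : B1 x -> height Psi x != 0 -> {for x, continuous (omega Psi a)}.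
Proof.
move=> hx h0; have hc := height_continuous dPsi (B1_xprime hx).
have ch : {for x, continuous (fun z => `|height Psi z|)} by exact: (cvg_norm hc).
have cl : {for x, continuous (fun z => ln `|height Psi z|)}.
  apply: (@continuous_comp _ _ _ (fun z => `|height Psi z|) (@ln R)) => //.
  by apply: continuous_ln; rewrite normr_gt0.
have ce : {for x, continuous (fun z => expR (a z * ln `|height Psi z|))}.
  apply: (@continuous_comp _ _ _ (fun z => a z * ln `|height Psi z|) (@expR R)).
    exact: (cvgM (ca hx) cl).
  exact: continuous_expR.
have E z : height Psi z != 0 -> expR (a z * ln `|height Psi z|) = omega Psi a z.
  by move=> hz; rewrite /omega /powR normr_eq0 (negbTE hz).
have hn : 0 < `|height Psi x| by rewrite normr_gt0.
have near0 : {near nbhs x, (fun z => expR (a z * ln `|height Psi z|)) =1 omega Psi a}.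
  have : nbhs x [set z | 0 < `|height Psi z|] by exact: (ch _ (lt_nbhsr hn)).
  by apply: filterS => z /=; rewrite normr_gt0 => /E.
rewrite /prop_for /continuous_at -E//.
exact: (cvg_trans (near_eq_cvg near0) ce).
Qed.

Definition dens f x : R := Num.max (f x) 0 / omega Psi a x.

Lemma dens_ge0 f x : 0 <= dens f x.
Proof. by rewrite divr_ge0 ?powR_ge0// le_max lexx orbT. Qed.

Lemma dens_continuous f x : B1 x -> height Psi x != 0 -> {for x, continuous f} ->
  {for x, continuous (dens f)}.
Proof.
move=> hx h0 cf.
have c1 : {for x, continuous (fun z => Num.max (f z) 0)}.
  by apply: continuous_max => //; exact: cst_continuous.
have w0 : omega Psi a x != 0 by rewrite gt_eqF// omega_gt0.
exact: (cvgM c1 (cvgV w0 (omega_continuous hx h0))).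
Qed.

Definition dens_osc_le (delta : R) (Om : set 'rV[R]_d) f (r : R) x : Prop :=
  ecball x r `<=` Om /\ forall z, ecball x r z -> `|dens f z - dens f x| <= delta.

(** Uniform in the center x' and in r, as the compactness argument of [contact_uniform_radius]
    requires. *)
Lemma dens_osc_near delta Om f x : 0 < delta -> nbhs x Om -> {for x, continuous (dens f)} ->
  exists2 r1, 0 < r1 & forall x' r, enorm (x' - x) < r1 -> r < r1 -> dens_osc_le delta Om f r x'.
Proof.
move=> d0 nO cd.
have d2 : 0 < delta / 2 by rewrite divr_gt0.
have n1 : nbhs x [set z | `|dens f x - dens f z| < delta / 2].
  by move: cd => /cvgrPdist_lt; exact.
have [r2 r20 hr2] := nbhs_eball (filterI nO n1).
exists (r2 / 2); first by rewrite divr_gt0.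
move=> x' r hx' hr.
have sub z : ecball x' r z -> eball x r2 z.
  rewrite /ecball /eball/= => hz.
  by apply: le_lt_trans (enorm_dist _ _ x') _; lra.
have [r_ge0|r_lt0] := leP 0 r; last first.
  have e z : ~ ecball x' r z.
    by rewrite /ecball/= => hz; have := le_lt_trans hz r_lt0; rewrite ltNge enorm_ge0.
  by split => z /e.
have x'x : eball x r2 x' by apply: sub; rewrite /ecball/= subrr enorm0.
split=> z /sub hz; first by have [] := hr2 _ hz.
have [_ /= h1] := hr2 _ hz; have [_ /= h2] := hr2 _ x'x.
rewrite (_ : dens f z - dens f x' = (dens f x - dens f x') - (dens f x - dens f z)); last by ring.
by apply: le_trans (ler_normB _ _) _; lra.
Qed.

End Density.

(** * The estimate *)

Section Core.
Context {R : realType} {n : nat}.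
Local Notation d := n.+2.
Variables (lam Lam alpha K C cB : R) (Psi : 'rV[R]_n.+1 -> R) (a : 'rV[R]_d -> R)
  (B : 'rV[R]_n.+1 -> 'rV[R]_d -> R).
Hypothesis lam0 : 0 < lam.
Hypothesis lamLam : lam <= Lam.
Hypothesis C0 : 0 <= C.
Hypothesis cB0 : 0 <= cB.
Hypothesis alpha0 : 0 < alpha.
Hypothesis K0 : 0 <= K.
Hypothesis dPsi : forall y, B1' y -> differentiable Psi y.
Hypothesis hPsi : forall y z, B1' y -> B1' z ->
    enorm (grad Psi y - grad Psi z) <= K * powR (enorm (y - z)) alpha.
Hypothesis hB : is_barrier lam Lam Psi C cB B.
Hypothesis ca : forall x, @B1 R n x -> {for x, continuous a}.
Variables (fP fM g u : 'rV[R]_d -> R).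
Hypothesis cu : continuous u.
Hypothesis cfP : forall x, OmegaP Psi x -> {for x, continuous fP}.
Hypothesis cfM : forall x, OmegaM Psi x -> {for x, continuous fM}.
Hypothesis viscP : visc_super_bulk lam Lam Psi a (OmegaP Psi) fP u.
Hypothesis viscM : visc_super_bulk lam Lam Psi a (OmegaM Psi) fM u.
Hypothesis viscI : visc_super_interface Psi g u.
Variables (G m0 H : R) (xs : 'rV[R]_d).
Hypothesis G0 : 0 <= G.
Hypothesis hg : forall x, Gamma Psi x -> g x < G / 2.
Hypothesis H0 : 0 < H.
Hypothesis hbd : forall x, @dB1 R n x -> - m0 <= u x.
Hypothesis B1xs : B1 xs.
Hypothesis hxs : u xs <= - m0 - H.
Hypothesis GcB : G * cB <= H / 4.

(** The set where u <= - m0 - H/4 is compact and misses the sphere, so its largest norm is below 1;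
    rho is the midpoint between that norm and 1. *)
Lemma deep_set_inside : exists2 rho, 0 <= rho < 1 &
  forall x, @cB1 R n x -> rho <= enorm x -> - m0 - H / 4 <= u x.
Proof.
pose A := @cB1 R n `&` [set x | u x <= - m0 - H / 4].
have cA : compact A.
  apply: compact_closedI; first exact: ecball_compact.
  rewrite (_ : mkset _ = u @^-1` [set t | t <= - m0 - H / 4])//.
  by apply: preimage_closed; [move=> x _; exact: cu|exact: closed_le].
have Axs : A xs.
  split; last by rewrite /=; have := hxs; have := H0; lra.
  by have := B1xs; rewrite /B1 /cB1 /eball /ecball/= => /ltW.
have cn : {within A, continuous (fun x : 'rV[R]_d => enorm x)}.
  by apply: continuous_in_subspaceT => x _; exact: enorm_continuous.
have [c] := compact_EVT_max (ex_intro _ _ Axs) cA cn.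
rewrite inE => -[]; rewrite /cB1 /ecball/= subr0 => c1 uc hc.
have c_lt1 : enorm c < 1.
  rewrite lt_neqAle c1 andbT; apply/eqP => e1.
  have := hbd (x := c); rewrite /dB1 /esphere/= subr0 => /(_ e1).
  have := H0; lra.
exists ((enorm c + 1) / 2); first by have := enorm_ge0 c; lra.
move=> x x1 hx; rewrite leNgt; apply/negP => ux.
have Ax : x \in A by rewrite inE; split => //=; exact: ltW.
have := hc _ Ax; lra.
Qed.

Section FixedRadius.
Variable rho : R.
Hypothesis rho01 : 0 <= rho < 1.
Hypothesis deep : forall x, @cB1 R n x -> rho <= enorm x -> - m0 - H / 4 <= u x.

Let rho1 : rho < 1. Proof. by case/andP: rho01. Qed.
Let rho0 : 0 <= rho. Proof. by case/andP: rho01. Qed.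
Let KB1' (y : 'rV[R]_n.+1) : ecball 0 rho y -> B1' y.
Proof. by rewrite /ecball /B1' /eball/= => /le_lt_trans; apply. Qed.

Local Notation cont := (contact B u G rho).

Lemma dotv_linear_continuous (p : 'rV[R]_d) : continuous (dotv p).
Proof. by move=> x; apply: dotv_continuous => //; exact: cst_continuous. Qed.

Lemma contact_exists p : exists x y, cont p x y.
Proof.
have nZ : @cB1 R n !=set0 by exists 0; rewrite /cB1 /ecball/= subr0 enorm0.
have cp : continuous (dotv p) by exact: dotv_linear_continuous.
have [x [y [h1 h2 h3]]] := perturbed_min hB G cu rho1 rho0 (@ecball_compact R d 0 1) nZ cp.
by exists x, y.
Qed.

(** If |x| >= rho, then [perturbed] is at least - m0 - H/4 - G cB >= - m0 - H/2 at x, but at most -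
    m0 - H at xs, and p.(x - xs) <= H/4 cannot make up the difference. *)
Lemma contact_inside p x y : enorm p <= H / 8 -> cont p x y -> enorm x < rho.
Proof.
move=> hp [x1 Ky hmin]; rewrite ltNge; apply/negP => xr.
have cxs : cB1 xs by have := B1xs; rewrite /B1 /cB1 /eball /ecball/= => /ltW.
have h1 := hmin xs y cxs Ky.
have h2 := perturbed_le B u G0 y xs.
have h3 := perturbed_ge hB u G0 x (KB1' Ky) cB0.
have h4 := deep x1 xr.
have h5 : dotv p (x - xs) <= H / 4.
  apply: le_trans (dotv_le _ _) _.
  have : enorm (x - xs) <= 2.
    apply: le_trans (enormB _ _) _.
    by move: x1 cxs; rewrite /cB1 /ecball/= !subr0; lra.
  have := enorm_ge0 (x - xs); have := enorm_ge0 p; have := hp; nra.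
rewrite dotvBr in h5; have := hxs; have := GcB; have := H0; lra.
Qed.

Lemma contact_off_interface p x y : enorm x < rho -> cont p x y -> ~ Gamma Psi x.
Proof.
move=> xr [x1 Ky hmin] Gx.
have [t0 t00 dec] := barrier_decay hB.
have Bx : B1 x by case: Gx.
have ht0 : height Psi x = 0 by rewrite /height; case: Gx => _ ->; rewrite subrr.
have w0 : perturbed B u G y x = u x.
  rewrite /perturbed (_ : Num.min 0 _ = 0) ?mulr0 ?addr0//; apply/min_idPl.
  by apply: (barrier_ge0 hB); [exact: KB1'|exact: B1_xprime|rewrite ht0].
have := hg Gx; rewrite ltNge => /negP; apply.
apply: (visc_interface_kink alpha0 K0 dPsi hPsi (p := p) viscI Gx); first by rewrite divr_ge0.
have hc := height_continuous dPsi (B1_xprime Bx).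
have n1 : \forall z \near x, height Psi z < t0.
  have ht : height Psi x < t0 by rewrite ht0.
  exact: (hc _ (lt_nbhsl ht)).
have n2 : \forall z \near x, enorm z < rho.
  have cx : {for x, continuous (fun z : 'rV[R]_d => enorm z)} by exact: enorm_continuous.
  exact: (cx _ (lt_nbhsl xr)).
near=> z => z1.
(* Since |x| < rho, z' is an admissible base point for z near x. Minimality against the pair (z, z')
   bends u up by G/2 times the positive part of the height. *)
have zr : enorm (xprime z) <= rho.
  by apply: le_trans (enorm_xprime _) _; apply: ltW; near: z.
have Kz : ecball 0 rho (xprime z) by rewrite /ecball/= subr0.
have := hmin z (xprime z) z1 Kz; rewrite w0 dotvBr.
have [hz|hz] := leP 0 (height Psi z).
  have hd : B (xprime z) z <= - (height Psi z / 2).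
    by apply: dec; [exact: KB1'|rewrite hz/=; apply: ltW; near: z].
  have h2 : G * Num.min 0 (B (xprime z) z) <= G * - (height Psi z / 2).
    by rewrite ler_wpM2l// ge_min hd orbT.
  by move: h2; rewrite /perturbed; lra.
have := perturbed_le B u G0 (xprime z) z.
by rewrite mulr0; lra.
Unshelve. all: by end_near. Qed.

(** Compactness in (x, y, p): near a contact triple the density varies little, since x lies off
    Gamma. Near any other triple there is no contact at all, so the claim is void there. *)
Lemma contact_uniform_radius delta : 0 < delta -> exists2 r, 0 < r &
  forall p x y, enorm p <= H / 8 -> cont p x y ->
    dens_osc_le Psi a delta (OmegaP Psi) fP r x \/ dens_osc_le Psi a delta (OmegaM Psi) fM r x.
Proof.
move=> d0.
pose T : Type := ('rV[R]_d * 'rV[R]_n.+1 * 'rV[R]_d)%type.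
pose X : set T := (@cB1 R n `*` ecball 0 rho) `*` ecball 0 (H / 8).
have cX : compact X.
  by apply: compact_setX; [apply: compact_setX|]; exact: ecball_compact.
pose P (r : R) (q : T) := cont q.2 q.1.1 q.1.2 ->
  dens_osc_le Psi a delta (OmegaP Psi) fP r q.1.1 \/ dens_osc_le Psi a delta (OmegaM Psi) fM r q.1.1.
have : \forall r \near 0^'+, X `<=` P r.
  apply: (compact_near_coveringP _).1 => // -[[x y] p] [[/= x1 Ky] hp].
  have cx : {for (x, y, p), continuous (fun q : T => q.1.1)}.
    by apply: (@continuous_comp _ _ _ fst fst); exact: cvg_fst.
  have cy : {for (x, y, p), continuous (fun q : T => q.1.2)}.
    by apply: (@continuous_comp _ _ _ fst snd); [exact: cvg_fst|exact: cvg_snd].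
  have cp : {for (x, y, p), continuous (fun q : T => q.2)} by exact: cvg_snd.
  have goodcase (Om : set 'rV[R]_d) (f : 'rV[R]_d -> R) : nbhs x Om ->
      {for x, continuous (dens Psi a f)} ->
      \forall q \near (x, y, p) & r \near 0^'+, dens_osc_le Psi a delta Om f r q.1.1.
    move=> nO cd; have [r1 r10 hr1] := dens_osc_near d0 nO cd.
    exists ([set q : T | eball x r1 q.1.1], [set r : R | r < r1]); last first.
      by move=> [q r] /= [h1 h2]; exact: hr1.
    by split; [exact: (cx _ (eball_nbhs x r10))|exact: nbhs_right_lt].
  have [hc|nc] := pselect (cont p x y).
    have hp8 : enorm p <= H / 8 by move: hp; rewrite /ecball/= subr0.
    have xr := contact_inside hp8 hc.
    have nG := contact_off_interface xr hc.
    have Bx : B1 x by rewrite /B1 /eball/= subr0 (lt_trans xr).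
    have [hx|hx|hx] := ltgtP 0 (height Psi x).
    - have Ox : OmegaP Psi x by split.
      have := @goodcase (OmegaP Psi) fP (OmegaP_nbhs dPsi Ox)
        (dens_continuous dPsi ca Bx (lt0r_neq0 hx) (cfP Ox)).
      by apply: filterS => q h _; left.
    - have Ox : OmegaM Psi x by split => //; rewrite oppr_gt0.
      have := @goodcase (OmegaM Psi) fM (OmegaM_nbhs dPsi Ox)
        (dens_continuous dPsi ca Bx (ltr0_neq0 hx) (cfM Ox)).
      by apply: filterS => q h _; right.
    - by exfalso; apply: nG; split => //; apply/eqP; rewrite -subr_eq0 -/(height Psi x) -hx.
  (* A competitor that is strictly better at (x, y, p) remains strictly better for nearby triples,
     by continuity. *)
  have [x2 [y2 [x21 Ky2 hlt]]] : exists x2 y2, [/\ cB1 x2, ecball 0 rho y2 &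
      perturbed B u G y2 x2 - dotv p x2 < perturbed B u G y x - dotv p x].
    apply: contrapT => hn; apply: nc; split => // x2 y2 x21 Ky2.
    by rewrite leNgt; apply/negP => hlt; apply: hn; exists x2, y2.
  have cw : {for (x, y, p), continuous (fun q : T => perturbed B u G q.1.2 q.1.1)}.
    by apply: (perturbed_continuous hB cu (f := fun q : T => q.1.2) (g := fun q : T => q.1.1)) => //=; exact: KB1'.
  have cd1 : {for (x, y, p), continuous (fun q : T => dotv q.2 q.1.1)} by exact: dotv_continuous.
  have cd2 : {for (x, y, p), continuous (fun q : T => dotv q.2 x2)}.
    by apply: dotv_continuous => //; exact: cst_continuous.
  have cF : {for (x, y, p), continuous (fun q : T => perturbed B u G q.1.2 q.1.1 - dotv q.2 q.1.1 + dotv q.2 x2)}.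
    exact: (cvgD (cvgB cw cd1) cd2).
  have nF : \forall q \near (x, y, p), perturbed B u G y2 x2 <
      perturbed B u G q.1.2 q.1.1 - dotv q.2 q.1.1 + dotv q.2 x2.
    have hlt2 : perturbed B u G y2 x2 < perturbed B u G y x - dotv p x + dotv p x2 by lra.
    exact: (cF _ (lt_nbhsr hlt2)).
  near=> q r => -[_ _ hmin].
  have : perturbed B u G y2 x2 <
      perturbed B u G q.1.2 q.1.1 - dotv q.2 q.1.1 + dotv q.2 x2 by near: q.
  have := hmin x2 y2 x21 Ky2; lra.
move=> hnear.
have [r [r0 hr]] : exists r : R, 0 < r /\ X `<=` P r.
  have hpos : \forall r \near 0^'+, 0 < r :> R by exact: nbhs_right_gt.
  near (0 : R)^'+ => r; exists r.
  by split; near: r.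
exists r => // p x y hp hc.
have := hr (x, y, p); apply => //.
case: hc => x1 Ky _; split => //=.
by rewrite /ecball/= subr0.
Unshelve. all: by end_near. Qed.

Section Covering.
Variables (delta r : R) (N : nat).
Hypothesis delta0 : 0 < delta.
Hypothesis r0 : 0 < r.
Hypothesis N0 : (0 < N)%N.
Hypothesis hr : forall p x y, enorm p <= H / 8 -> cont p x y ->
    dens_osc_le Psi a delta (OmegaP Psi) fP r x \/ dens_osc_le Psi a delta (OmegaM Psi) fM r x.

(** The cubes of side e tile [-1, 1)^d, and s bounds their Euclidean diameter. *)
Let e : R := 2 / N%:R.
Let s : R := d%:R * e.
Hypothesis sr : s <= r.
Hypothesis sr2 : 32 * Lam * d%:R * s ^+ 2 <= lam * r ^+ 2.

Let e0 : 0 < e. Proof. by rewrite divr_gt0// ltr0n. Qed.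
Let s0 : 0 < s. Proof. by rewrite mulr_gt0// ltr0n. Qed.

Let in_box (j : d.-tuple 'I_N) (x : 'rV[R]_d) : Prop :=
  forall i, cell (-1) e (tnth j i) (x ord0 i).

Lemma box_exists x : B1 x -> exists j, in_box j x.
Proof.
move=> hx; have h i : exists j : 'I_N, cell (-1) e j (x ord0 i).
  apply: cell_exists => //; rewrite /e divfK ?pnatr_eq0 -?lt0n//.
  have : `|x ord0 i| < 1.
    by apply: le_lt_trans (coord_le_enorm _ _) _; move: hx; rewrite /B1 /eball/= subr0.
  rewrite ltr_norml => /andP[h1 h2]; rewrite (ltW h1)/=; lra.
have [j hj] := choice h.
by exists [tuple j i | i < d] => i; rewrite tnth_mktuple.
Qed.

Lemma box_dist j x z : in_box j x -> in_box j z -> enorm (x - z) <= s.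
Proof.
move=> hx hz; apply: enorm_le_coord; first exact: ltW.
by move=> i; rewrite !mxE; exact: (cell_dist (hx i) (hz i)).
Qed.

Lemma contact_slopes (Om : set 'rV[R]_d) f p0 x0 y0 p1 x1 y1 :
  visc_super_bulk lam Lam Psi a Om f u -> Om `<=` @B1 R n ->
  (forall x, Om x -> height Psi x != 0) ->
  dens_osc_le Psi a delta Om f r x0 -> cont p0 x0 y0 -> cont p1 x1 y1 -> enorm (x1 - x0) <= s ->
  enorm (p1 - p0) <= 32 / lam * (dens Psi a f x0 + delta + G * C) * s.
Proof.
move=> visc OB Oh [gO gd] h0 h1 hx.
apply: (contact_pair lam0 lamLam hB C0 G0 cu rho1 rho0 visc h0 h1 hx s0 r0 sr2 gO OB).
  move=> x xr; have om0 : 0 < omega Psi a x by apply: omega_gt0; exact: Oh (gO _ xr).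
  split=> //; have := gd _ xr; rewrite ler_norml => /andP[_ hd].
  apply: (@le_trans _ _ (Num.max (f x) 0)); first by rewrite le_max lexx.
  have -> : Num.max (f x) 0 = omega Psi a x * dens Psi a f x.
    by rewrite /dens mulrC divfK// gt_eqF.
  by rewrite ler_pM2l//; lra.
by rewrite !addr_ge0 ?dens_ge0 ?mulr_ge0// ltW.
Qed.

(** As s <= r, the whole cube around X j lies in the ball where the density differs from its value
    at X j by at most delta. *)
Lemma cells_integral_lower (Om : set 'rV[R]_d) f (I : R) (Q : pred (d.-tuple 'I_N)) (X : d.-tuple 'I_N -> 'rV[R]_d) :
  (forall j, Q j -> in_box j (X j) /\ dens_osc_le Psi a delta Om f r (X j)) ->
  integral_Rd (fun x => (\1_Om x * `|Num.max (f x) 0 / omega Psi a x| ^+ d)%:E) = I%:E ->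
  \sum_(j | Q j) e ^+ d * (Num.max (dens Psi a f (X j) - delta) 0) ^+ d <= I.
Proof.
move=> hX hI.
pose c (j : d.-tuple 'I_N) : R := if Q j then (Num.max (dens Psi a f (X j) - delta) 0) ^+ d else 0.
have := @iter_int_cells_lower R d N (fun t : seq R =>
  (\1_Om (@pt R n t) * `|Num.max (f (@pt R n t)) 0 / omega Psi a (@pt R n t)| ^+ d)%:E) (-1) e c e0.
have hI' : iter_int d (fun t : seq R => (\1_Om (@pt R n t)
    * `|Num.max (f (@pt R n t)) 0 / omega Psi a (@pt R n t)| ^+ d)%:E) = I%:E by exact: hI.
rewrite hI' lee_fin => hh.
rewrite big_mkcond/= (eq_bigr (fun j => e ^+ d * c j)); last first.
  by move=> j _; rewrite /c; case: ifP => // _; rewrite mulr0.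
apply: hh.
- by move=> j; rewrite /c; case: ifP => // _; rewrite exprn_ge0// le_max lexx orbT.
- by move=> t; rewrite lee_fin mulr_ge0// exprn_ge0.
- move=> j t jt; rewrite /c; case: ifP => Qj; last by rewrite lee_fin mulr_ge0// exprn_ge0.
  have [bx [gO gd]] := hX _ Qj.
  have bt : in_box j (@pt R n t) by move=> i; rewrite mxE; exact: in_cellP.
  have zr : ecball (X j) r (@pt R n t).
    by rewrite /ecball/=; apply: le_trans sr; exact: box_dist bt bx.
  rewrite lee_fin indicE mem_set ?mul1r; last exact: gO.
  rewrite -/(dens Psi a f _) ger0_norm ?dens_ge0// lerXn2r ?nnegrE ?dens_ge0 ?le_max ?lexx ?orbT//.
  rewrite ge_max dens_ge0 andbT; have := gd _ zr; rewrite ler_norml => /andP[]; lra.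
Qed.

(** Each occupied cube contributes one witness slope, and all slopes with contact points in that
    cube lie within [rad] of it. They cover the cube of side H / (8 d), whose points have norm at
    most H / 8 and are thus contact slopes. *)
Lemma covering_estimate (IP IM : R) :
  integral_Rd (fun x => (\1_(OmegaP Psi) x * `|Num.max (fP x) 0 / omega Psi a x| ^+ d)%:E) = IP%:E ->
  integral_Rd (fun x => (\1_(OmegaM Psi) x * `|Num.max (fM x) 0 / omega Psi a x| ^+ d)%:E) = IM%:E ->
  (H / (8 * d%:R)) ^+ d <=
    (192 * d%:R / lam) ^+ d * (IP + IM + (2 * (2 * delta + G * C)) ^+ d).
Proof.
move=> hIP hIM.
pose occ (j : d.-tuple 'I_N) := exists q : 'rV[R]_d * 'rV[R]_d * 'rV[R]_n.+1,
  [/\ enorm q.1.1 <= H / 8, cont q.1.1 q.1.2 q.2 & in_box j q.1.2].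
have [W hW] : exists W : d.-tuple 'I_N -> 'rV[R]_d * 'rV[R]_d * 'rV[R]_n.+1,
    forall j, occ j -> [/\ enorm (W j).1.1 <= H / 8, cont (W j).1.1 (W j).1.2 (W j).2 & in_box j (W j).1.2].
  have hc (j : d.-tuple 'I_N) : exists q : 'rV[R]_d * 'rV[R]_d * 'rV[R]_n.+1,
      occ j -> [/\ enorm q.1.1 <= H / 8, cont q.1.1 q.1.2 q.2 & in_box j q.1.2].
    have [[q hq]|no] := pselect (occ j); first by exists q.
    by exists (0, 0, 0) => /no.
  by have [W hW] := choice hc; exists W.
pose P j := `[< occ j >].
pose X j := (W j).1.2.
pose QP j := P j && `[< dens_osc_le Psi a delta (OmegaP Psi) fP r (X j) >].
pose QM j := P j && ~~ `[< dens_osc_le Psi a delta (OmegaP Psi) fP r (X j) >].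
have PX j : P j -> in_box j (X j) by move=> /asboolP/hW[].
have goodM j : QM j -> dens_osc_le Psi a delta (OmegaM Psi) fM r (X j).
  move=> /andP[/asboolP/hW[h1 h2 _] /asboolPn h3].
  by have [] := hr h1 h2.
have hP : OmegaP Psi `<=` @B1 R n by move=> x [].
have hM : OmegaM Psi `<=` @B1 R n by move=> x [].
have nP x : OmegaP Psi x -> height Psi x != 0 by move=> [_ h]; rewrite gt_eqF.
have nM x : OmegaM Psi x -> height Psi x != 0.
  by move=> [_]; rewrite oppr_gt0 => h; rewrite lt_eqF.
pose kap j := if `[< dens_osc_le Psi a delta (OmegaP Psi) fP r (X j) >]
  then dens Psi a fP (X j) else dens Psi a fM (X j).
(* Chosen so that kap + delta + G C <= (kap - delta)_+ + E: the first part is a lower Riemann sum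
   term, and the second is the same for all cubes. *)
pose E := 2 * delta + G * C.
have E0 : 0 < E by rewrite ltr_pwDl ?mulr_gt0 ?mulr_ge0.
pose c j := Num.max (kap j - delta) 0.
have c0 j : 0 <= c j by rewrite le_max lexx orbT.
pose rad j := 32 / lam * (c j + E) * s.
have rad0 j : 0 < rad j.
  by apply: mulr_gt0 => //; apply: mulr_gt0; [rewrite divr_gt0|rewrite ltr_wpDl].
have A0 : 0 < H / (8 * d%:R) by rewrite divr_gt0// mulr_gt0// ltr0n.
have cov (q : 'rV[R]_d) : (forall i, 0 <= q ord0 i <= H / (8 * d%:R)) ->
    exists2 j, P j & forall i, `|q ord0 i - (W j).1.1 ord0 i| <= rad j.
  move=> hq; have qn : enorm q <= H / 8.
    apply: le_trans (_ : d%:R * (H / (8 * d%:R)) <= _).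
      by apply: enorm_le_coord; [exact: ltW|move=> i; have /andP[h1 h2] := hq i; rewrite ger0_norm].
    have dn : d%:R != 0 :> R by rewrite pnatr_eq0.
    move: dn; move: (d%:R : R) => D dn.
    by rewrite le_eqVlt; apply/orP; left; apply/eqP; field.
  have [x [y hc]] := contact_exists q.
  have xr := contact_inside qn hc.
  have Bx : B1 x by rewrite /B1 /eball/= subr0 (lt_trans xr).
  have [j jx] := box_exists Bx.
  have oj : occ j by exists (q, x, y).
  have Pj : P j by apply/asboolP.
  exists j => // i; have [h1 h2 h3] := hW _ oj.
  have xx : enorm (x - X j) <= s by exact: box_dist jx h3.
  have -> : q ord0 i - (W j).1.1 ord0 i = (q - (W j).1.1) ord0 i by rewrite !mxE.
  apply: le_trans (coord_le_enorm _ _) _.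
  have key : enorm (q - (W j).1.1) <= 32 / lam * (kap j + delta + G * C) * s.
    rewrite /kap; case: asboolP => hgood.
      exact: (contact_slopes viscP hP nP hgood h2 hc xx).
    have hgM : dens_osc_le Psi a delta (OmegaM Psi) fM r (X j).
      by apply: goodM; rewrite /QM Pj/=; apply/asboolPn.
    exact: (contact_slopes viscM hM nM hgM h2 hc xx).
  apply: le_trans key _; rewrite /rad ler_pM2r// ler_pM2l ?divr_gt0//.
  have : kap j - delta <= c j by rewrite le_max lexx.
  by rewrite /E; lra.
have := @covering_volume R d _ P (fun j => (W j).1.1) rad _ A0 (fun j _ => rad0 j) cov.
move=> /le_trans; apply.
(* Here 3 * 32 * s = 96 d e, and splitting the power of a sum doubles the factor. *)
have step j : (3 * rad j) ^+ d <= (192 * d%:R / lam) ^+ d * (e ^+ d * c j ^+ d + e ^+ d * E ^+ d).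
  have -> : 3 * rad j = 96 * d%:R / lam * e * (c j + E) by rewrite /rad /s; field; rewrite gt_eqF.
  have -> : 192 * d%:R / lam = 2 * (96 * d%:R / lam) by field; rewrite gt_eqF.
  apply: scaled_powD_le => //; try exact: ltW.
  by rewrite divr_ge0 ?mulr_ge0// ltW.
apply: le_trans (ler_sum _ (fun j _ => step j)) _.
rewrite -mulr_sumr ler_wpM2l ?exprn_ge0 ?mulr_ge0 ?invr_ge0 ?(ltW lam0)//.
rewrite big_split/= lerD//.
  rewrite (bigID (fun j => `[< dens_osc_le Psi a delta (OmegaP Psi) fP r (X j) >]))/= lerD//.
    have hQ j : QP j -> in_box j (X j) /\ dens_osc_le Psi a delta (OmegaP Psi) fP r (X j).
      by move=> /andP[Pj /asboolP hg']; split => //; exact: PX.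
    apply: le_trans (cells_integral_lower hQ hIP).
    rewrite le_eqVlt; apply/orP; left; apply/eqP.
    by apply: eq_bigr => j /andP[_ hj]; rewrite /c /kap hj.
  have hQ j : QM j -> in_box j (X j) /\ dens_osc_le Psi a delta (OmegaM Psi) fM r (X j).
    by move=> hj; split; [case/andP: hj => /PX|exact: goodM].
  apply: le_trans (cells_integral_lower hQ hIM).
  rewrite le_eqVlt; apply/orP; left; apply/eqP.
  by apply: eq_bigr => j /andP[_ /negbTE hj]; rewrite /c /kap hj.
apply: le_trans (_ : \sum_(j : d.-tuple 'I_N) e ^+ d * E ^+ d <= _).
  rewrite [X in _ <= X](bigID P)/= lerDl; apply: sumr_ge0 => j _.
  by rewrite mulr_ge0 ?exprn_ge0// ltW.
rewrite sumr_const card_tuple card_ord -[X in X <= _]mulr_natl natrX mulrA -exprMn.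
(* The N^d cubes have total volume 2^d. *)
have -> : N%:R * e = 2 by rewrite /e mulrC divfK ?pnatr_eq0 -?lt0n.
by rewrite -exprMn.
Qed.

End Covering.

End FixedRadius.
End Core.

(** All terms are nonnegative and c > 0, so one infinite term makes the right-hand side infinite and
    only real values need work. *)
Lemma ereal_affine_bound (R : realType) (X S g N1 N2 : \bar R) (c : R) : 0 < c ->
  (0 <= S)%E -> (0 <= g)%E -> (0 <= N1)%E -> (0 <= N2)%E ->
  (forall s' g' n1 n2 : R, S = s'%:E -> g = g'%:E -> N1 = n1%:E -> N2 = n2%:E ->
    (X <= (s' + c * (g' + n1 + n2))%:E)%E) ->
  (X <= S + c%:E * (g + N1 + N2))%E.
Proof.
move=> c0; case: S => [s| |]// s0; case: g => [g| |]// g0; case: N1 => [n1| |]// n10;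
  case: N2 => [n2| |]// n20 h; rewrite ?addye ?addey// ?gt0_muley ?lte_fin// ?addye ?addey// ?leey//.
exact: h.
Qed.

(** * Choice of parameters and conclusion *)

Section Final.
Context {R : realType} {n : nat}.
Local Notation d := n.+2.

(** N is taken so large that s q <= r, where q >= 1 gives s <= r and lam q^2 >= lam q >= 32 Lam d
    gives the other bound. *)
Lemma exists_grid (Lam lam r : R) : 0 < lam -> 0 <= Lam -> 0 < r ->
  exists2 N, (0 < N)%N & d%:R * (2 / N%:R) <= r /\
    32 * Lam * d%:R * (d%:R * (2 / N%:R)) ^+ 2 <= lam * r ^+ 2.
Proof.
move=> lam0 Lam0 r0.
pose q := 1 + 32 * Lam * d%:R / lam.
have q1 : 1 <= q by rewrite lerDl divr_ge0 ?mulr_ge0// ltW.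
have q0 : 0 < q by exact: lt_le_trans q1.
pose N := (Num.truncn (2 * d%:R * q / r)).+1.
have N0 : 0 < N%:R :> R by rewrite ltr0n.
have hN : 2 * d%:R * q / r <= N%:R.
  have D0 : 0 <= 2 * d%:R * q / r by rewrite divr_ge0 ?mulr_ge0// ltW.
  by have /andP[_ /ltW] := truncn_itv D0.
have hs : d%:R * (2 / N%:R) * q <= r.
  rewrite ler_pdivrMr// in hN.
  have -> : d%:R * (2 / N%:R) * q = 2 * d%:R * q / N%:R by ring.
  by rewrite ler_pdivrMr// [r * _]mulrC.
have s0 : 0 <= d%:R * (2 / N%:R) :> R by rewrite mulr_ge0// divr_ge0// ltW.
exists N => //; split; first by apply: le_trans hs; rewrite ler_peMr.
move: hs s0; move: (d%:R * (2 / N%:R)) => s hs s0.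
have h1 : 32 * Lam * d%:R <= lam * q ^+ 2.
  have : 32 * Lam * d%:R <= lam * q.
    have -> : lam * q = lam + 32 * Lam * d%:R by rewrite /q; field; rewrite gt_eqF.
    by rewrite lerDr ltW.
  by move=> /le_trans; apply; rewrite ler_wpM2l ?(ltW lam0)// expr2 ler_peMr// ltW.
have h2 : (s * q) ^+ 2 <= r ^+ 2 by rewrite lerXn2r ?nnegrE ?mulr_ge0// ltW.
have := ler_wpM2r (sqr_ge0 s) h1; have := ler_wpM2l (ltW lam0) h2.
by rewrite exprMn; lra.
Qed.

Lemma abp_real_estimate (lam Lam alpha : R) (Psi : 'rV[R]_n.+1 -> R) (a : 'rV[R]_d -> R) :
  0 < lam -> lam <= Lam -> 0 < alpha < 1 -> C1alpha_B1' alpha Psi ->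
  (forall x, @B1 R n x -> {for x, continuous a}) ->
  exists2 CC, 0 < CC & forall (fP fM g u : 'rV[R]_d -> R) (m0 g0 NP NM : R) xs,
    (forall x, OmegaP Psi x -> {for x, continuous fP}) ->
    (forall x, OmegaM Psi x -> {for x, continuous fM}) ->
    {within @cB1 R n, continuous u} ->
    visc_super_bulk lam Lam Psi a (OmegaP Psi) fP u ->
    visc_super_bulk lam Lam Psi a (OmegaM Psi) fM u ->
    visc_super_interface Psi g u ->
    0 <= g0 -> (forall x, Gamma Psi x -> g x <= g0) ->
    (forall x, @dB1 R n x -> - m0 <= u x) ->
    0 <= NP -> 0 <= NM ->
    integral_Rd (fun x => (\1_(OmegaP Psi) x * `|Num.max (fP x) 0 / omega Psi a x| ^+ d)%:E)
      = (NP ^+ d)%:E ->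
    integral_Rd (fun x => (\1_(OmegaM Psi) x * `|Num.max (fM x) 0 / omega Psi a x| ^+ d)%:E)
      = (NM ^+ d)%:E ->
    B1 xs -> - u xs <= m0 + CC * (g0 + NM + NP).
Proof.
move=> lam0 lL a01 hC ca.
have [C [cB [B [C0 cB0 hB]]]] := barrier_exists lam0 lL a01 hC.
have [dP [K1 hK1]] := hC; have /andP[a0 a1] := a01.
pose K := Num.max K1 0.
have K0 : 0 <= K by rewrite le_max lexx orbT.
have hP y z : B1' y -> B1' z -> enorm (grad Psi y - grad Psi z) <= K * powR (enorm (y - z)) alpha.
  move=> hy hz; apply: le_trans (hK1 _ _ hy hz) _.
  by rewrite ler_wpM2r ?powR_ge0// le_max lexx.
pose Q := 8 * d%:R * (192 * d%:R / lam).
have Q0 : 0 < Q by rewrite !mulr_gt0 ?invr_gt0 ?ltr0n.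
pose CC := 8 * cB + Q * (4 + 4 * C).
have CC0 : 0 < CC by rewrite ltr_wpDl ?mulr_ge0// mulr_gt0// ltr_pwDl// mulr_ge0.
exists CC => // fP fM g u m0 g0 NP NM xs cfP cfM cu vP vM vI g00 hg hbd NP0 NM0 hIP hIM Bxs.
apply/ler_addgt0Pr => eta0 eta00.
(* The slack eta makes g < G / 2 strict, even for g0 = 0, and serves also as the oscillation delta;
   it is removed at the end because eta0 is arbitrary. *)
pose eta := eta0 / CC.
have eta_gt0 : 0 < eta by rewrite divr_gt0.
have -> : m0 + CC * (g0 + NM + NP) + eta0 = m0 + CC * (g0 + NM + NP + eta).
  by rewrite [in RHS]mulrDr [CC * eta]mulrC /eta divfK ?gt_eqF// addrA.
pose S := g0 + NM + NP + eta.
have S0 : 0 <= S by rewrite /S; lra.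
have [Hneg|H0] := leP (- u xs - m0) 0.
  have := mulr_ge0 (ltW CC0) S0; rewrite -/S; lra.
suff : - u xs - m0 <= CC * S by rewrite -/S; lra.
move: H0; set H := - u xs - m0 => H0.
have [v cv vu] := continuous_ball_extension cu.
have B1c x : B1 x -> v x = u x.
  by move=> hx; apply: vu; move: hx; rewrite /B1 /eball /ecball/= => /ltW.
have bulk (Om : set 'rV[R]_d) f : Om `<=` @B1 R n -> visc_super_bulk lam Lam Psi a Om f u ->
    visc_super_bulk lam Lam Psi a Om f v.
  move=> OB vis x0 phi Ox [r [r0 [C2 [e1 e2]]]]; apply: vis => //.
  exists r; split => //; split => //; split; first by rewrite e1 B1c//; exact: OB.
  by move=> x xr x1; rewrite -(vu _ x1); exact: e2.
have vP' : visc_super_bulk lam Lam Psi a (OmegaP Psi) fP v by apply: bulk => // x [].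
have vM' : visc_super_bulk lam Lam Psi a (OmegaM Psi) fM v by apply: bulk => // x [].
have vI' : visc_super_interface Psi g v.
  move=> x0 de phi phiP phiM Gx de0 c1 c2 e1 e2 e3 e4.
  apply: (vI x0 de phi phiP phiM) => //; first by rewrite e3 B1c//; case: Gx.
  by move=> x xr x1; rewrite -(vu _ x1); exact: e4.
pose G := 2 * (g0 + eta).
have G0 : 0 <= G by rewrite mulr_ge0// addr_ge0// ltW.
have hg' x : Gamma Psi x -> g x < G / 2.
  by move=> /hg hx; rewrite /G mulrC mulKf//; apply: le_lt_trans hx _; rewrite ltrDl.
have hbd' x : @dB1 R n x -> - m0 <= v x.
  move=> hx; rewrite vu; first exact: hbd.
  by move: hx; rewrite /dB1 /esphere /ecball/= => ->.
have hxs : v xs <= - m0 - H by rewrite B1c// /H; lra.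
have [GcB|GcB] := leP (G * cB) (H / 4); last first.
  have h1 : (g0 + eta) * cB <= S * cB by rewrite ler_wpM2r// /S; lra.
  have h2 : 0 <= Q * (4 + 4 * C) * S.
    by apply: mulr_ge0 => //; apply: mulr_ge0; [exact: ltW|move: C0; lra].
  by move: GcB; rewrite /CC /G; lra.
have [rho rho01 deep] := deep_set_inside cv H0 hbd' Bxs hxs.
have d0 : 0 < eta by [].
have [r r0 hr] := contact_uniform_radius cB0 a0 K0 dP hP hB ca cv cfP cfM vI'
  G0 hg' H0 Bxs hxs GcB rho01 deep d0.
have [N N0 [sr sr2]] := exists_grid lam0 (le_trans (ltW lam0) lL) r0.
have := covering_estimate lam0 lL C0 cB0 hB cv vP' vM' G0 H0 Bxs hxs GcB rho01 deep d0 r0 N0 hr sr sr2 hIP hIM.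
set E := 2 * (2 * eta + G * C) => est.
have E0 : 0 <= E by have := mulr_ge0 G0 C0; rewrite /E; lra.
have q0 : 0 <= 192 * d%:R / lam by rewrite divr_ge0 ?mulr_ge0// ltW.
have {}est : (H / (8 * d%:R)) ^+ d <= (192 * d%:R / lam * (NP + NM + E)) ^+ d.
  rewrite [leRHS]exprMn; apply: le_trans est _; rewrite ler_wpM2l ?sum_pow_le//.
  exact: exprn_ge0.
have {}est : H / (8 * d%:R) <= 192 * d%:R / lam * (NP + NM + E).
  rewrite -(ler_pXn2r (ltn0Sn n.+1)) ?nnegrE//.
    by rewrite divr_ge0 ?mulr_ge0// ltW.
  by apply: mulr_ge0 => //; lra.
rewrite ler_pdivrMr ?mulr_gt0 ?ltr0n// in est.
apply: le_trans est _.
have -> : 192 * d%:R / lam * (NP + NM + E) * (8 * d%:R) = Q * (NP + NM + E) by rewrite /Q; ring.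
have h1 : NP + NM + E <= (4 + 4 * C) * S.
  have : 0 <= C * NP by rewrite mulr_ge0.
  have : 0 <= C * NM by rewrite mulr_ge0.
  by rewrite /E /G /S; lra.
have h2 : Q * (NP + NM + E) <= Q * ((4 + 4 * C) * S) by rewrite ler_wpM2l// ltW.
apply: le_trans h2 _; rewrite mulrA /CC [leRHS]mulrDl lerDr.
by apply: mulr_ge0 => //; apply: mulr_ge0.
Qed.

End Final.

(* d = n.+2 (so d >= 2, x' in R^(d-1)) *)
Theorem mainTheorem4 (R : realType) (n : nat) (lam Lam alpha0 : R)
  (Psi : 'rV[R]_(n.+1) -> R) (a : 'rV[R]_(n.+2) -> R) :
  0 < lam -> lam <= Lam -> 0 < alpha0 < 1 ->
  C1alpha_B1' alpha0 Psi ->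
  (forall x, @B1 R n x -> {for x, continuous a}) ->
  (forall x, @B1 R n x -> 0 <= a x < 1) ->
  (exists amax : R, amax < 1 /\ forall x, @B1 R n x -> a x <= amax) ->
  exists C : R, forall (fP fM g u : 'rV[R]_(n.+2) -> R),
    (forall x, OmegaP Psi x -> {for x, continuous fP}) ->
    (forall x, OmegaM Psi x -> {for x, continuous fM}) ->
    (exists M : R, forall x, (OmegaP Psi x \/ OmegaM Psi x) -> `|fP x| <= M /\ `|fM x| <= M) ->
    (exists M : R, forall x, Gamma Psi x -> `|g x| <= M) ->
    {within @cB1 R n, continuous u} ->
    visc_super_bulk lam Lam Psi a (OmegaP Psi) fP u ->
    visc_super_bulk lam Lam Psi a (OmegaM Psi) fM u ->
    visc_super_interface Psi g u ->
    (ereal_sup [set (Num.max (- u x) 0%R)%:E | x in @B1 R n]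
     <= ereal_sup [set (Num.max (- u x) 0%R)%:E | x in @dB1 R n]
        + C%:E * (ereal_sup ([set (Num.max (g x) 0%R)%:E | x in Gamma Psi] `|` [set 0%E])
                  + LdNorm_omega Psi a (OmegaM Psi) (fun x => Num.max (fM x) 0%R)
                  + LdNorm_omega Psi a (OmegaP Psi) (fun x => Num.max (fP x) 0%R)))%E.
Proof.
move=> lam0 lL a01 hC ca _ _.
have [CC CC0 est] := abp_real_estimate lam0 lL a01 hC ca.
exists CC => fP fM g u cfP cfM _ _ cu vP vM vI.
set S := ereal_sup [set _ | x in @dB1 R n].
set g0 := ereal_sup (_ `|` _).
set NM := LdNorm_omega _ _ (OmegaM Psi) _.
set NP := LdNorm_omega _ _ (OmegaP Psi) _.
have hS x : @dB1 R n x -> ((Num.max (- u x) 0)%:E <= S)%E.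
  by move=> hx; apply: ereal_sup_ubound; exists x.
have S0 : (0 <= S)%E.
  (* The sphere is nonempty; otherwise the supremum over it would be minus infinity. *)
  have h1 : @dB1 R n (evec R ord0) by rewrite /dB1 /esphere/= subr0 enorm_evec.
  by apply: le_trans (hS _ h1); rewrite lee_fin le_max lexx orbT.
have hg0 x : Gamma Psi x -> ((Num.max (g x) 0)%:E <= g0)%E.
  by move=> hx; apply: ereal_sup_ubound; left; exists x.
have g00 : (0 <= g0)%E by apply: ereal_sup_ubound; right.
have NP0 : (0 <= NP)%E by exact: poweR_ge0.
have NM0 : (0 <= NM)%E by exact: poweR_ge0.
have int_ge0 (U : set 'rV[R]_n.+2) (h : 'rV[R]_n.+2 -> R) :
    (0 <= integral_Rd (fun x => (\1_U x * `|h x / omega Psi a x| ^+ n.+2)%:E))%E.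
  by apply: iter_int_ge0 => s; rewrite lee_fin mulr_ge0// exprn_ge0.
apply: (ereal_affine_bound CC0 S0 g00 NM0 NP0) => m0 gr nm np eS eg em ep.
have [iM nm0] := poweR_root_fin (int_ge0 (OmegaM Psi) (fun x => Num.max (fM x) 0)) em.
have [iP np0] := poweR_root_fin (int_ge0 (OmegaP Psi) (fun x => Num.max (fP x) 0)) ep.
have m00 : 0 <= m0 by rewrite -lee_fin -eS.
have gr0 : 0 <= gr by rewrite -lee_fin -eg.
apply: ge_ereal_sup => _ [x Bx <-]; rewrite lee_fin ge_max; apply/andP; split; last first.
  by rewrite addr_ge0// mulr_ge0 ?addr_ge0// ltW.
apply: (est fP fM g u m0 gr np nm x) => //.
- move=> z Gz; have := hg0 _ Gz; rewrite eg lee_fin; apply: le_trans.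
  by rewrite le_max lexx.
- move=> z Sz; have := hS _ Sz; rewrite eS lee_fin lerNl; apply: le_trans.
  by rewrite le_max lexx.
Qed.
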